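(* Let $\widehat\alpha_n$ be the PSMD estimator and assume that conditions [ID], [PEN], [CRIT] and [LOC] hold. If in addition [PHI] and [LQA] hold, then $$\sqrt n\,\frac{\phi(\widehat\alpha_n)-\phi(\alpha_0)}{\|v_n^*\|_{sd}}=-\sqrt n\,\mathbb Z_n+o_{P_{Z^\infty}}(1)\Rightarrow N(0,1).$$ (All objects and the bracketed conditions are defined in the context.)
   Context: MODEL. $Z=(Y',X')'$; $Z_1,Z_2,\dots$ are i.i.d. copies, $Z_i=(Y_i',X_i')'$, $Z^n=(Z_1,\dots,Z_n)$; $P_{Z^\infty}$ is the law of the sequence ($o_P,O_P$ and wpa1 = ''with probability approaching one'' refer to it); $\mathcal X$ is the support of $X$; $\|\cdot\|_e$ is the Euclidean norm; $a_n\asymp b_n$ means $c_1a_n\le b_n\le c_2a_n$ for constants $0<c_1\le c_2<\infty$. $\mathcal A=\Theta\times\mathcal H$ with $\Theta\subset\mathbb R^{d_\theta}$ and $\mathcal H$ a space of functions with norm $\|\cdot\|_{\mathbf H}$; for $\alpha=(\theta',h)$, $\|\alpha\|_s=\|\theta\|_e+\|h\|_{\mathbf H}$. $\rho(Z;\alpha)\in\mathbb R^{d_\rho}$ is a known function, $m(X,\alpha)=E[\rho(Z;\alpha)|X]$, and $\alpha_0=(\theta_0',h_0)\in\mathrm{int}(\Theta)\times\mathcal H$ satisfies $m(X,\alpha_0)=0$ a.s. $\Sigma(X)$ is a positive definite weighting matrix, $\Sigma_0(X)=\mathrm{Var}(\rho(Z;\alpha_0)|X)$, $Q(\alpha)=E[m(X,\alpha)'\Sigma(X)^{-1}m(X,\alpha)]$.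 ESTIMATOR. $\widehat m(x,\alpha)=\sum_{i=1}^n\rho(Z_i,\alpha)A_n(X_i,x)$ is a consistent estimator of $m$ ($A_n(X_i,x)$ a known measurable function of $X_1,\dots,X_n$), $\widehat\Sigma$ is a consistent estimator of $\Sigma$, $\widehat Q_n(\alpha)=\frac1n\sum_{i=1}^n\widehat m(X_i,\alpha)'\widehat\Sigma(X_i)^{-1}\widehat m(X_i,\alpha)$. Sieve: $\mathcal A_{k(n)}=\Theta\times\mathcal H_{k(n)}$, $\mathcal H_{k(n)}=\{h\in\mathcal H:h=\sum_{k\le k(n)}\beta_kq_k\}$ for known basis functions $q_k$, $k(n)\to\infty$. $Pen\ge0$ is a penalty on $\mathcal H$, $\lambda_n=o(1)$. The PSMD (penalized sieve minimum distance) estimator $\widehat\alpha_n=(\widehat\theta_n',\widehat h_n)\in\mathcal A_{k(n)}$ satisfies $\widehat Q_n(\widehat\alpha_n)+\lambda_nPen(\widehat h_n)\le\inf_{\alpha\in\mathcal A_{k(n)}}\{\widehat Q_n(\alpha)+\lambda_nPen(h)\}+o_P(n^{-1})$. LOCAL OBJECTS. $\dot m_\alpha(X)[v]=\partial_\tau m(X,\alpha+\tau v)|_{\tau=0}$, $\dot\phi_\alpha[v]=\partial_\tau\phi(\alpha+\tau v)|_{\tau=0}$ (pathwise derivatives), $\dot m=\dot m_{\alpha_0}$, $\dot\phi=\dot\phi_{\alpha_0}$. $\langle v_1,v_2\rangle=E[\dot m(X)[v_1]'\Sigma(X)^{-1}\dot m(X)[v_2]]$, $\|v\|^2=\langle v,v\rangle$.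 $\mathcal A_{os}$ is a convex $\|\cdot\|_s$-neighbourhood of $\alpha_0$ contained in $\{\alpha\in\mathcal A:\|\alpha-\alpha_0\|_s<M_0,\ \lambda_nPen(h)<\lambda_nM_0\}$; $\mathcal A_{osn}=\mathcal A_{os}\cap\mathcal A_{k(n)}$. With $\Pi_n h_0$ as in [ID](ii), $\Pi_n\alpha_0=(\theta_0',\Pi_nh_0)$. $\tau_n=\sup\{\|\alpha-\Pi_n\alpha_0\|_s/\|\alpha-\Pi_n\alpha_0\|:\alpha\in\mathcal A_{osn},\|\alpha-\Pi_n\alpha_0\|\ne0\}$. $\bar\delta_{m,n}\downarrow0$ and $\delta_n=o(1)$, $\delta_n\le\bar\delta_{m,n}$, are positive sequences; $\delta_{s,n}=\|h_0-\Pi_nh_0\|_s+\tau_n\delta_n=o(1)$; $M_n=\min\{\log\log(n+1),\log(\delta_{s,n}^{-1}+1)\}$. $\mathcal N_{os}=\{\alpha\in\mathcal A:\|\alpha-\alpha_0\|\le M_n\delta_n,\|\alpha-\alpha_0\|_s\le M_n\delta_{s,n},\lambda_nPen(h)\le\lambda_nM_0\}$, $\mathcal N_{osn}=\mathcal N_{os}\cap\mathcal A_{k(n)}$, $\mathcal T_n=\{t\in\mathbb R:|t|\le4M_n^2\delta_n\}$. $\mathcal A_{k(n)}^{M_0}=\{\alpha\in\mathcal A_{k(n)}:\lambda_nPen(h)\le\lambda_nM_0\}$, with $M_0$ finite and so large that it contains $\Pi_n\alpha_0$, and contains $\widehat\alpha_n$ with probability arbitrarily close to one for all large $n$. RIESZ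 REPRESENTER. $\phi:\mathbb R^{d_\theta}\times\mathcal H\to\mathbb R$ is $\|\cdot\|_s$-continuous and $\dot\phi$ is a $\|\cdot\|_s$-bounded linear functional. $\mathbf V$ is the linear span of $\mathcal A_{os}-\{\alpha_0\}$, $\overline{\mathbf V}$ its closure under $\|\cdot\|$; $\alpha_{0,n}$ minimizes $\|\alpha-\alpha_0\|$ over $\mathbb R^{d_\theta}\times\mathcal H_{k(n)}$; $\overline{\mathbf V}_{k(n)}$ is the closed linear span under $\|\cdot\|$ of $\mathcal A_{osn}-\{\alpha_{0,n}\}$, with $\dim\overline{\mathbf V}_{k(n)}=\dim\mathcal A_{k(n)}\asymp k(n)$; $v_n^*\in\overline{\mathbf V}_{k(n)}$ is the unique element with $\dot\phi[v]=\langle v_n^*,v\rangle$ for all $v\in\overline{\mathbf V}_{k(n)}$. $\|v\|_{sd}^2=E[\dot m(X)[v]'\Sigma(X)^{-1}\Sigma_0(X)\Sigma(X)^{-1}\dot m(X)[v]]$, $u_n^*=v_n^*/\|v_n^*\|_{sd}$, $\mathbb Z_n=\frac1n\sum_{i=1}^n\dot m(X_i)[u_n^*]'\Sigma(X_i)^{-1}\rho(Z_i,\alpha_0)$. CONDITIONS. [ID] (i) $E[\rho(Z;\alpha)|X]=0$ a.s. iff $\alpha\in\mathcal A$ with $\|\alpha-\alpha_0\|_s=0$; (ii) $\Theta$ is compact with nonempty interior, $\{\mathcal H_k\}_{k\ge1}$ is a non-decreasing sequence of nonempty closed linear subsets of the Banach space $(\mathcal H,\|\cdot\|_{\mathbf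 H})$ with $\mathcal H=cl(\cup_k\mathcal H_k)$, and there is $\Pi_nh_0\in\mathcal H_{k(n)}$ with $\|\Pi_nh_0-h_0\|_{\mathbf H}=o(1)$; (iii) $Q$ is lower semicontinuous on $(\mathcal A,\|\cdot\|_s)$; (iv) the eigenvalues of $\Sigma(x),\Sigma_0(x)$ are bounded and bounded away from zero uniformly in $x\in\mathcal X$. [PEN] (i) $\lambda_n>0$, $Q(\Pi_n\alpha_0)+o(n^{-1})=O(\lambda_n)=o(1)$; (ii) $|Pen(\Pi_nh_0)-Pen(h_0)|=O(1)$, $Pen(h_0)<\infty$; (iii) for every $M$, $\{h\in\mathcal H:Pen(h)\le M\}$ is compact in $(\mathcal H,\|\cdot\|_{\mathbf H})$. [CRIT] (i) $\widehat Q_n(\Pi_n\alpha_0)\le c_0Q(\Pi_n\alpha_0)+o_P(n^{-1})$ for a finite $c_0>0$; (ii) $\widehat Q_n(\alpha)\ge cQ(\alpha)-O_P(\bar\delta_{m,n}^2)$ uniformly over $\mathcal A_{k(n)}^{M_0}$ for a finite $c>0$. [LOC] (i) $m(\cdot,\alpha)$ is continuously pathwise differentiable in $\alpha\in\mathcal A_{os}$ and $\|\alpha-\alpha_0\|\le C\|\alpha-\alpha_0\|_s$ on $\mathcal A_{os}$ for a finite $C$; (ii) $Q(\alpha)\asymp\|\alpha-\alpha_0\|^2$ on $\mathcal A_{os}$; (iii) $\widehat Q_n(\alpha)\ge cQ(\alpha)-O_P(\delta_n^2)$ uniformly over $\mathcal A_{osn}$, and $\max\{\delta_n^2,Q(\Pi_n\alpha_0),\lambda_n,o(n^{-1})\}=\delta_n^2$;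 (iv) $\lambda_n\sup_{\alpha,\alpha'\in\mathcal A_{os}}|Pen(h)-Pen(h')|=o(n^{-1})$ or $\lambda_n=o(n^{-1})$. [PHI] (i) $\dot\phi$ is a nonzero linear functional on $\mathbf V$; $\{\overline{\mathbf V}_k\}$ is an increasing sequence of finite dimensional Hilbert spaces dense in $(\overline{\mathbf V},\|\cdot\|)$; $\|v_n^*\|/\sqrt n=o(1)$; (ii) $\sup_{(\alpha,t)\in\mathcal N_{osn}\times\mathcal T_n}\sqrt n\,|\phi(\alpha+tu_n^* )-\phi(\alpha_0)-\dot\phi[\alpha+tu_n^*-\alpha_0]|/\|v_n^*\|=o(1)$; (iii) $\sqrt n\,|\dot\phi[\alpha_{0,n}-\alpha_0]|/\|v_n^*\|=o(1)$. [LQA] (i) with $\alpha(t)=\alpha+tu_n^*$, $\alpha(t)\in\mathcal A_{k(n)}$ for all $(\alpha,t)\in\mathcal N_{osn}\times\mathcal T_n$, and with $\widehat\Lambda_n(\alpha(t),\alpha)=\frac12\{\widehat Q_n(\alpha(t))-\widehat Q_n(\alpha)\}$ and $r_n(t)=(\max\{t^2,tn^{-1/2},o(n^{-1})\})^{-1}$, $\sup_{(\alpha,t)\in\mathcal N_{osn}\times\mathcal T_n}r_n(t)|\widehat\Lambda_n(\alpha(t),\alpha)-t\{\mathbb Z_n+\langle u_n^*,\alpha-\alpha_0\rangle\}-\frac{B_n}2t^2|=o_P(1)$, where $B_n$ is a positive $Z^n$-measurable random variable, $B_n=O_P(1)$; (ii) $\sqrt n\,\mathbb Z_n\Rightarrow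 N(0,1)$.
   Formalization: As literally read the conditions force dim H finite, so A_os is a neighbourhood only relative to {Pen<M_0}, and M_0 is also assumed so large that Pen(Π_n h_0)<M_0 and, wpa1, the penalty of α̂_n+t u_n^* is below M_0 for all t in T_n. *)

(* Defs.v *)
From HB Require Import structures.
From mathcomp Require Import all_boot all_order all_algebra.
From mathcomp Require Import all_classical all_reals all_analysis.
Set Implicit Arguments.
Unset Strict Implicit.
Unset Printing Implicit Defensive.
Import Order.TTheory GRing.Theory Num.Theory.
Import numFieldNormedType.Exports.
Local Open Scope classical_set_scope.
Local Open Scope ring_scope.

(* R^n with its Borel sigma-algebra. *)
Definition borel_rV (R : realType) (n : nat) :=
  g_sigma_algebraType (@open 'rV[R]_n).

Notation obs R dy dx := ((borel_rV R dy * borel_rV R dx)%type).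

Section linear_spans.
Context (R : realType) (E : lmodType R).

Definition span (S : set E) : set E :=
  [set v | exists N (c : nat -> R) (u : nat -> E),
     (forall i, (i < N)%N -> S (u i)) /\ v = \sum_(i < N) c i *: u i].

Definition has_dim (V : set E) (d : nat) :=
  exists b : 'I_d -> E,
    (forall c : 'I_d -> R, \sum_i c i *: b i = 0 -> forall i, c i = 0) /\
    V = [set v | exists c : 'I_d -> R, v = \sum_i c i *: b i].

End linear_spans.

(* Stochastic orders. Suprema over infinite-dimensional sets need not be      *)
(* measurable, so "with probability at least p" is read in inner probability; *)
(* on measurable events this is the usual notion.                             *)
Section stochastic_orders.
Context d (Om : measurableType d) (R : realType) (P : probability Om R).

Definition prob_ge (E : set Om) (p : R) :=
  exists F, [/\ measurable F, F `<=` E & (p%:E <= P F)%E].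

Definition wpa1 (E : nat -> set Om) :=
  forall e, 0 < e -> \forall n \near \oo, prob_ge (E n) (1 - e).

(* E K n holds with probability close to one, for K large enough and then     *)
(* for all large n.                                                           *)
Definition bounded_in_prob (E : R -> nat -> set Om) :=
  forall e, 0 < e -> exists K : R,
    \forall n \near \oo, prob_ge (E K n) (1 - e).

Definition OP (X : nat -> Om -> R) (a : nat -> R) :=
  bounded_in_prob (fun K n => [set w | `|X n w| <= K * a n]).

Definition oP1 (X : nat -> Om -> R) :=
  forall e, 0 < e -> wpa1 (fun n => [set w | `|X n w| <= e]).

Definition cvg_in_law (X : nat -> Om -> R)
    (mu : probability (measurableTypeR R) R) :=
  (forall n, measurable_fun setT (X n)) /\
  forall x, mu [set x] = 0%E ->
    P [set w | X n w <= x] @[n --> \oo] --> mu [set y | y <= x].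

End stochastic_orders.

Section conditional_expectation.
Context (R : realType) (dy dx : nat) (PZ : probability (obs R dy dx) R).

(* g(X) is a version of E[f(Z) | X]. *)
Definition is_cond_exp (f : obs R dy dx -> R) (g : borel_rV R dx -> R) :=
  [/\ PZ.-integrable setT (EFin \o f), measurable_fun setT g &
      forall B : set (borel_rV R dx), measurable B ->
        (\int[PZ]_(z in snd @^-1` B) (g z.2)%:E =
         \int[PZ]_(z in snd @^-1` B) (f z)%:E)%E].

Definition supportX : set 'rV[R]_dx :=
  [set x | forall U : set 'rV[R]_dx, open U -> U x ->
     (0 < PZ [set z | U z.2])%E].

End conditional_expectation.

(* The population side: law of Z = (Y, X), residual function, parameter       *)
(* space, functional of interest. mu_ is a version of m(x, alpha).            *)
Record population (R : realType) (dy dx drho dth : nat)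
    (H : completeNormedModType R) := Population {
  PZ : probability (obs R dy dx) R ;
  rho : obs R dy dx -> 'rV[R]_dth * H -> 'rV[R]_drho ;
  mu_ : borel_rV R dx -> 'rV[R]_dth * H -> 'rV[R]_drho ;
  Sigma : borel_rV R dx -> 'M[R]_drho ;
  Sigma0 : borel_rV R dx -> 'M[R]_drho ;
  Theta : set 'rV[R]_dth ;
  alpha0 : 'rV[R]_dth * H ;
  Pen : H -> \bar R ;
  phi : 'rV[R]_dth * H -> R }.

(* Sieve, tuning sequences and local objects. eta is the o(1/n) rate common   *)
(* to the optimization error, the penalty level and the LQA remainder.        *)
Record design (R : realType) (dth : nat) (H : completeNormedModType R) :=
  Design {
  q : nat -> H ;
  kn : nat -> nat ;
  lam : nat -> R ;
  eta : nat -> R ;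
  dbar : nat -> R ;
  delta : nat -> R ;
  Pih0 : nat -> H ;
  M0 : R ;
  Aos : set ('rV[R]_dth * H) ;
  alpha0n : nat -> 'rV[R]_dth * H ;
  vstar : nat -> 'rV[R]_dth * H }.

(* An n w xi x is the weight A_n(xi, x), a function of X_1, ..., X_n.         *)
Record sample (R : realType) (dy dx drho dth : nat)
    (H : completeNormedModType R) d (Om : measurableType d) := Sample {
  Z : nat -> Om -> obs R dy dx ;
  An : nat -> Om -> borel_rV R dx -> borel_rV R dx -> R ;
  Shat : nat -> Om -> borel_rV R dx -> 'M[R]_drho ;
  ahat : nat -> Om -> 'rV[R]_dth * H ;
  Bn : nat -> Om -> R }.

Section objects.
Context (R : realType) (dy dx drho dth : nat) (H : completeNormedModType R).
Context (M : population dy dx drho dth H) (D : design dth H).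

Local Notation E := ('rV[R]_dth * H)%type.
Local Notation XT := (borel_rV R dx).
Local Notation ZT := (obs R dy dx).
Local Notation PZ := (PZ M).
Local Notation alpha0 := (alpha0 M).
Local Notation lam := (lam D).

Definition enorm n (u : 'rV[R]_n) : R := Num.sqrt (\sum_j u 0 j ^+ 2).

(* The norm topology of E is that of snorm: the sup norm and the Euclidean    *)
(* norm on R^dth are equivalent.                                              *)
Definition snorm (a : E) : R := enorm a.1 + `|a.2|.

Definition qform (S : 'M[R]_drho) (u w : 'rV[R]_drho) : R :=
  (u *m S *m w^T) 0 0.

Definition Q (a : E) : \bar R :=
  (\int[PZ]_z (qform (invmx (Sigma M z.2)) (mu_ M z.2 a) (mu_ M z.2 a))%:E)%E.

Definition mdot (a : E) (x : XT) (v : E) : 'rV[R]_drho := 'D_v (mu_ M x) a.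

Definition phidot (v : E) : R := 'D_v (phi M) alpha0.

Definition ip (v w : E) : R :=
  \int[PZ]_z (qform (invmx (Sigma M z.2)) (mdot alpha0 z.2 v)
                                          (mdot alpha0 z.2 w)).

Definition wnorm (v : E) : R := Num.sqrt (ip v v).

Definition sdnorm (v : E) : R :=
  Num.sqrt (\int[PZ]_z
    (qform (invmx (Sigma M z.2) *m Sigma0 M z.2 *m invmx (Sigma M z.2))
       (mdot alpha0 z.2 v) (mdot alpha0 z.2 v))).

Definition A : set E := [set a | Theta M a.1].

Definition Hk (K : nat) : set H :=
  [set h | exists b : nat -> R, h = \sum_(i < K) b i *: q D i].

Definition Lk (n : nat) : set E := [set a | Hk (kn D n) a.2].

Definition Ak (n : nat) : set E := A `&` Lk n.

Definition pen_le (n : nat) (a : E) :=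
  ((lam n)%:E * Pen M a.2 <= (lam n * M0 D)%:E)%E.

Definition pen_lt (n : nat) (a : E) :=
  ((lam n)%:E * Pen M a.2 < (lam n * M0 D)%:E)%E.

Definition AkM0 (n : nat) : set E := [set a | Ak n a /\ pen_le n a].

Definition Aosn (n : nat) : set E := Aos D `&` Ak n.

Definition Pia0 (n : nat) : E := (alpha0.1, Pih0 D n).

Definition ratios (n : nat) : set R :=
  [set r | exists a, [/\ Aosn n a, wnorm (a - Pia0 n) != 0 &
     r = snorm (a - Pia0 n) / wnorm (a - Pia0 n)]].

Definition tau (n : nat) : R := sup (ratios n).

Definition delta_s (n : nat) : R :=
  `|alpha0.2 - Pih0 D n| + tau n * delta D n.

Definition Mn (n : nat) : R :=
  Num.min (ln (ln n.+1%:R)) (ln ((delta_s n)^-1 + 1)).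

Definition Nos (n : nat) : set E :=
  [set a | [/\ A a, wnorm (a - alpha0) <= Mn n * delta D n,
               snorm (a - alpha0) <= Mn n * delta_s n & pen_le n a]].

Definition Nosn (n : nat) : set E := Nos n `&` Ak n.

Definition Tn (n : nat) : set R :=
  [set t | `|t| <= 4%:R * Mn n ^+ 2 * delta D n].

Definition V : set E := span [set a - alpha0 | a in Aos D].

(* Directions in which m(X, .) has a pathwise derivative at alpha0 with       *)
(* finite second moment; the library's 'D_v carries no meaning elsewhere.     *)
Definition diff_dir : set E :=
  [set v | {ae PZ, forall z, derivable (mu_ M z.2) alpha0 v} /\
           forall j, (fun z => mdot alpha0 z.2 v 0 j) \in Lfun PZ 2%:E].

(* Closure of V under wnorm. *)
Definition Vbar : set E :=
  [set v | forall e, 0 < e ->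
     exists w, [/\ V w, diff_dir (v - w) & wnorm (v - w) < e]].

(* A finite-dimensional subspace on which wnorm is a norm is wnorm-closed, so *)
(* the closed linear span of Aosn - alpha0n is its span.                      *)
Definition Vk (n : nat) : set E :=
  span [set a - alpha0n D n | a in Aosn n].

Definition ustar (n : nat) : E := (sdnorm (vstar D n))^-1 *: vstar D n.

Definition rn (n : nat) (t : R) : R :=
  (Num.max (t ^+ 2) (Num.max (t * (Num.sqrt n%:R)^-1) (eta D n)))^-1.

Definition is_o_inv (a : nat -> R) := (n%:R * a n) @[n --> \oo] --> (0 : R).

Definition sup_pen_diff : R :=
  sup [set r | exists a b, [/\ Aos D a, Aos D b &
                 r = `|fine (Pen M a.2) - fine (Pen M b.2)|]].

Definition sym_posdef (S : 'M[R]_drho) :=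
  S^T = S /\ forall u : 'rV[R]_drho, u != 0 -> 0 < qform S u u.

Definition model_ok :=
  [/\ forall a, A a -> forall j,
        is_cond_exp PZ (fun z => rho M z a 0 j) (fun x => mu_ M x a 0 j),
      (forall j l, measurable_fun setT (fun x : XT => Sigma M x j l)) /\
        (forall x, supportX PZ x -> sym_posdef (Sigma M x)),
      forall j l, is_cond_exp PZ
        (fun z => (rho M z alpha0 0 j - mu_ M z.2 alpha0 0 j) *
                  (rho M z alpha0 0 l - mu_ M z.2 alpha0 0 l))
        (fun x => Sigma0 M x j l),
      interior (Theta M) alpha0.1 &
      {ae PZ, forall z, mu_ M z.2 alpha0 = 0}] /\
  forall h, (0 <= Pen M h)%E.

Definition design_ok :=
  [/\ (kn D @ \oo --> \oo) /\ (lam @ \oo --> (0 : R)),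
      (forall n, 0 < eta D n) /\ is_o_inv (eta D),
      [/\ forall n, 0 < dbar D n, forall n, dbar D n.+1 <= dbar D n &
          dbar D @ \oo --> (0 : R)] &
      [/\ forall n, 0 < delta D n <= dbar D n,
          delta D @ \oo --> (0 : R),
          forall n, has_ubound (ratios n) &
          delta_s @ \oo --> (0 : R)]].

(* Aos is a neighbourhood of alpha0 relative to the effective parameter space *)
(* {Pen < M0}. An absolute neighbourhood on which Pen < M0 would, by          *)
(* compactness of the level sets of Pen, make H finite-dimensional.           *)
Definition Aos_ok :=
  [/\ convex_set (Aos D : set (convex_lmodType E)),
      forall n, Aos D `<=`
        [set a | [/\ A a, snorm (a - alpha0) < M0 D & pen_lt n a]] &
      exists2 r, 0 < r & forall n a,
        A a -> snorm (a - alpha0) < r -> pen_lt n a -> Aos D a].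

(* ip is a semi-inner product on the tangent space Vbar. *)
Definition tangent_ok :=
  [/\ Vbar `<=` diff_dir,
      forall c v w, Vbar v -> Vbar w -> Vbar (c *: v + w) &
      forall c v w, Vbar v -> Vbar w ->
        {ae PZ, forall z, mdot alpha0 z.2 (c *: v + w) =
                          c *: mdot alpha0 z.2 v + mdot alpha0 z.2 w}].

Definition riesz_ok :=
  [/\ continuous (phi M),
      [/\ forall v, derivable (phi M) alpha0 v,
          forall c v w, phidot (c *: v + w) = c * phidot v + phidot w &
          exists C : R, forall v, `|phidot v| <= C * snorm v],
      forall n, Lk n (alpha0n D n) /\
        (forall a, Lk n a -> wnorm (alpha0n D n - alpha0) <= wnorm (a - alpha0)),
      exists dim : nat -> nat,
        (forall n, has_dim (Vk n) (dim n) /\ has_dim (Lk n) (dim n)) /\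
        exists c1 c2 : R, 0 < c1 <= c2 /\
          forall n, c1 * (kn D n)%:R <= (dim n)%:R <= c2 * (kn D n)%:R &
      forall n, Vk n (vstar D n) /\
        (forall v, Vk n v -> phidot v = ip (vstar D n) v)].

Definition cond_ID :=
  [/\ forall a, A a ->
        ({ae PZ, forall z, mu_ M z.2 a = 0} <-> snorm (a - alpha0) = 0),
      [/\ compact (Theta M), interior (Theta M) !=set0,
          forall K, [/\ Hk K !=set0, closed (Hk K) & Hk K `<=` Hk K.+1],
          closure (\bigcup_K Hk K) = setT &
          (forall n, Hk (kn D n) (Pih0 D n)) /\
          `|Pih0 D n - alpha0.2| @[n --> \oo] --> (0 : R)],
      forall a, A a -> forall y : R, (y%:E < Q a)%E ->
        exists2 r, 0 < r & forall b, A b -> snorm (b - a) < r -> (y%:E < Q b)%E &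
      exists c1 c2 : R, 0 < c1 <= c2 /\ forall x, supportX PZ x ->
        forall l, (eigenvalue (Sigma M x) l || eigenvalue (Sigma0 M x) l) ->
          c1 <= l <= c2].

Definition cond_PEN :=
  [/\ [/\ forall n, 0 < lam n,
          exists C : R, forall n, (Q (Pia0 n) + (eta D n)%:E <= (C * lam n)%:E)%E &
          lam @ \oo --> (0 : R)],
      (exists C : R, forall n,
         (`|Pen M (Pih0 D n) - Pen M alpha0.2| <= C%:E)%E) /\
      (Pen M alpha0.2 < +oo)%E &
      forall b : R, compact [set h | (Pen M h <= b%:E)%E]].

End objects.

Section estimation.
Context (R : realType) (dy dx drho dth : nat) (H : completeNormedModType R).
Context (M : population dy dx drho dth H) (D : design dth H).
Context d (Om : measurableType d) (P : probability Om R).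
Context (S : sample dy dx drho dth H Om).

Local Notation E := ('rV[R]_dth * H)%type.
Local Notation XT := (borel_rV R dx).
Local Notation ZT := (obs R dy dx).
Local Notation X i w := (Z S i w).2.
Local Notation alpha0 := (alpha0 M).

Definition iid :=
  [/\ forall i, measurable_fun setT (Z S i),
      forall i (B : set ZT), measurable B -> P (Z S i @^-1` B) = PZ M B &
      forall n (B : nat -> set ZT), (forall i, measurable (B i)) ->
        P (\bigcap_(i in [set i | (i < n)%N]) (Z S i @^-1` B i)) =
        (\prod_(i < n) P (Z S i @^-1` B i))%E].

(* Measurability with respect to sigma(F 0, ..., F n.-1). *)
Definition gen_measurable d' (T : measurableType d') (F : nat -> Om -> T)
    (n : nat) (f : Om -> R) :=
  forall B : set (measurableTypeR R), measurable B ->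
    <<s [set G | exists i C, [/\ (i < n)%N, measurable C & G = F i @^-1` C] ] >>
      (f @^-1` B).

Definition mhat (n : nat) (w : Om) (x : XT) (a : E) : 'rV[R]_drho :=
  \sum_(i < n) An S n w (X i w) x *: rho M (Z S i w) a.

Definition Qhat (n : nat) (w : Om) (a : E) : R :=
  n%:R^-1 * \sum_(i < n) qform (invmx (Shat S n w (X i w)))
                           (mhat n w (X i w) a) (mhat n w (X i w) a).

(* Convergence in probability of random functions of x, in P_X-measure. *)
Definition consistent p r (fhat : nat -> Om -> XT -> 'M[R]_(p, r))
    (f : XT -> 'M[R]_(p, r)) :=
  forall e, 0 < e -> wpa1 P (fun n => [set w | exists B : set XT,
    [/\ measurable B, ((1 - e)%:E <= PZ M [set z | B z.2])%E &
        forall x, B x -> forall i j, `|fhat n w x i j - f x i j| <= e]]).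

Definition sample_ok :=
  [/\ iid,
      forall n x y, gen_measurable (fun i w => X i w) n (fun w => An S n w y x),
      forall a, A M a -> consistent (fun n w x => mhat n w x a)
                           (fun x => mu_ M x a) &
      consistent (Shat S) (Sigma M)].

Definition crit (n : nat) (w : Om) (a : E) : \bar R :=
  ((Qhat n w a)%:E + (lam D n)%:E * Pen M a.2)%E.

(* The estimator is a Borel random element. An o_P(1/n) error is O_P(eta_n)   *)
(* for a deterministic eta_n = o(1/n).                                        *)
Definition psmd :=
  [/\ forall n w, Ak M D n (ahat S n w),
      forall n (U : set E), open U -> measurable (ahat S n @^-1` U) &
      bounded_in_prob P (fun K n => [set w |
        (crit n w (ahat S n w) <=
         ereal_inf [set crit n w a | a in Ak M D n] + (K * eta D n)%:E)%E])].

(* "M0 so large": the level M0 contains Pi_n alpha0 and the estimator, and is *)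
(* not binding at Pi_n alpha0 nor at the local perturbations of the estimator *)
(* in the direction ustar.                                                    *)
Definition M0_large :=
  [/\ forall n, AkM0 M D n (Pia0 M D n),
      wpa1 P (fun n => [set w | AkM0 M D n (ahat S n w)]),
      forall n, pen_lt M D n (Pia0 M D n) &
      wpa1 P (fun n => [set w | forall t, Tn M D n t ->
        pen_lt M D n (ahat S n w + t *: ustar M D n)])].

Definition Qhat_lower (dom : nat -> set E) (rate : nat -> R) :=
  exists2 c : R, 0 < c & bounded_in_prob P (fun K n => [set w |
    forall a, dom n a ->
      (c%:E * Q M a <= (Qhat n w a + K * rate n ^+ 2)%:E)%E]).

Definition cond_CRIT :=
  (exists2 c0 : R, 0 < c0 & bounded_in_prob P (fun K n => [set w |
     ((Qhat n w (Pia0 M D n))%:E <=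
      c0%:E * Q M (Pia0 M D n) + (K * eta D n)%:E)%E])) /\
  Qhat_lower (AkM0 M D) (dbar D).

Definition cond_LOC :=
  [/\ {ae PZ M, forall z,
        (forall a v, Aos D a -> V M D v -> derivable (mu_ M z.2) a v) /\
        (forall v, V M D v ->
           {within Aos D, continuous (fun a => mdot M a z.2 v)})} /\
      (exists C : R, forall a, Aos D a ->
         wnorm M (a - alpha0) <= C * snorm (a - alpha0)),
      exists c1 c2 : R, 0 < c1 <= c2 /\ forall a, Aos D a ->
        ((c1 * wnorm M (a - alpha0) ^+ 2)%:E <= Q M a <=
         (c2 * wnorm M (a - alpha0) ^+ 2)%:E)%E,
      Qhat_lower (Aosn M D) (delta D) /\
      (forall n, maxe (delta D n ^+ 2)%:E
         (maxe (Q M (Pia0 M D n)) (maxe (lam D n)%:E (eta D n)%:E)) =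
         (delta D n ^+ 2)%:E) &
      is_o_inv (fun n => lam D n * sup_pen_diff M D) \/ is_o_inv (lam D)].

Definition cond_PHI :=
  [/\ [/\ exists2 v, V M D v & phidot M v != 0,
          forall n n', (kn D n <= kn D n')%N -> Vk M D n `<=` Vk M D n',
          forall n, Vk M D n `<=` Vbar M D /\
            (forall v, Vk M D n v -> wnorm M v = 0 -> v = 0),
          forall v, Vbar M D v -> forall e, 0 < e ->
            exists n w, Vk M D n w /\ wnorm M (v - w) < e &
          (wnorm M (vstar D n) / Num.sqrt n%:R) @[n --> \oo] --> (0 : R)],
      forall e, 0 < e -> \forall n \near \oo, forall a t,
        Nosn M D n a -> Tn M D n t ->
        let at_ := a + t *: ustar M D n in
        Num.sqrt n%:R *
          `|phi M at_ - phi M alpha0 - phidot M (at_ - alpha0)|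
          / wnorm M (vstar D n) <= e &
      (Num.sqrt n%:R * `|phidot M (alpha0n D n - alpha0)|
         / wnorm M (vstar D n)) @[n --> \oo] --> (0 : R)].

Definition Zn (n : nat) (w : Om) : R :=
  n%:R^-1 * \sum_(i < n)
    qform (invmx (Sigma M (X i w))) (mdot M alpha0 (X i w) (ustar M D n))
          (rho M (Z S i w) alpha0).

Definition Lambda_hat (n : nat) (w : Om) (b a : E) : R :=
  2%:R^-1 * (Qhat n w b - Qhat n w a).

Definition cond_LQA :=
  [/\ forall n a t, Nosn M D n a -> Tn M D n t ->
        Ak M D n (a + t *: ustar M D n),
      forall e, 0 < e -> wpa1 P (fun n => [set w | forall a t,
        Nosn M D n a -> Tn M D n t ->
        rn D n t * `|Lambda_hat n w (a + t *: ustar M D n) a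
                     - t * (Zn n w + ip M (ustar M D n) (a - alpha0))
                     - Bn S n w / 2%:R * t ^+ 2| <= e]),
      [/\ forall n w, 0 < Bn S n w,
          forall n, gen_measurable (Z S) n (Bn S n) &
          OP P (Bn S) (fun _ => 1)] &
      cvg_in_law P (fun n w => Num.sqrt n%:R * Zn n w) (normal_prob 0 1)].

End estimation.

(* Main.v *)
Require Import Defs.
From mathcomp Require Import all_boot all_order all_algebra.
From mathcomp Require Import all_classical all_reals all_analysis.
From mathcomp Require Import measurable_realfun ring lra.
Import Order.TTheory GRing.Theory Num.Theory.
Import numFieldNormedType.Exports.
Local Open Scope classical_set_scope.
Local Open Scope ring_scope.
Set Implicit Arguments.
Unset Strict Implicit.
Unset Printing Implicit Defensive.

(** The estimator nearly minimizes a criterion whose sample version is locally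
    quadratic along the direction [ustar], with linear coefficient
    [X = Zn + ip ustar (ahat - alpha0)]. A small step [+- t] along [ustar] must not
    decrease the criterion, and this squeezes [X] to [o_P(n^{-1/2})]
    ([score_oP1]). On the other hand [ip vstar] represents [phidot] on the sieve
    and is orthogonal to the approximation error of the sieve ([ip_vstar]), so
    [ip ustar (ahat - alpha0)] equals [phidot (ahat - alpha0) / sdnorm vstar] up to a
    bias; by linearization of [phi] this is the normalized estimation error,
    and hence [T = - sqrt n * Zn + o_P(1)]. The limit law follows from Slutsky's lemma
    and the symmetry of the normal law ([cvg_in_law_oppD_oP1]).

    The expansions hold only on the shrinking neighbourhood [Nosn], so the estimator
    must first be located there ([ahat_Nosn]). Consistency comes from compactness:
    [Q] is lower semicontinuous and positive off [alpha0], hence bounded below off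
    any neighbourhood of it when the penalty is bounded ([Q_identification]), whereas
    [Q] is small at the estimator by comparison with [Pia0]
    ([Qhat_ahat_bounded]). The same comparison inside [Aos], where [Q] is equivalent to
    [wnorm ^+ 2], gives the rates ([ahat_rates]), and [Mn] diverges ([near_Mn_ge]).

    Two points need care. The perturbed estimator must remain in [Aos], where the
    penalty oscillates by [o(1/n)]; this holds because the much longer segment
    [ahat + Tn *: ustar] stays in a bounded set ([ahat_shift_Aosn]). Remainders are
    controlled relative to [wnorm vstar], while [T] is normalized by
    [sdnorm vstar]; the two norms are compared through the eigenvalue bounds
    on [Sigma] and [Sigma0] ([wnorm_le_sdnorm]), which by Rayleigh's principle are
    bounds on the quadratic forms ([eigenvalue_ge_qform]). The same bounds make [ip] a
    finite semi-inner product on [Vbar]. *)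

(** * Stochastic orders *)

Section prob_ge_theory.
Context d (Om : measurableType d) (R : realType) (P : probability Om R).

Lemma prob_ge_sub (A B : set Om) p : A `<=` B -> prob_ge P A p -> prob_ge P B p.
Proof.
by move=> AB [F [mF FA pF]]; exists F; split => //; exact: subset_trans AB.
Qed.

(** Stated with the probabilities of the exceptional events, which add up. *)
Lemma prob_geI (A B : set Om) p q :
  prob_ge P A (1 - p) -> prob_ge P B (1 - q) -> prob_ge P (A `&` B) (1 - (p + q)).
Proof.
move=> [F [mF FA pF]] [G [mG GB qG]]; exists (F `&` G); split.
- exact: measurableI.
- exact: setISS.
have fn (C : set Om) : measurable C -> P C \is a fin_num by exact: fin_num_measure.
have mFG := measurableI _ _ mF mG; have mFD := measurableD mF mG.
have : (P (F `\` G) <= P (~` G))%E.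
  by apply: le_measure; [rewrite inE|rewrite inE; exact: measurableC|move=> w []].
rewrite probability_setC//; move: pF qG; rewrite (measureDI P mF mG).
rewrite -(fineK (fn _ mG)) -(fineK (fn _ mFG)) -(fineK (fn _ mFD)).
have -> : (P (F `\` G) + P (F `&` G) =
    (fine (P (F `\` G)) + fine (P (F `&` G)))%:E)%E.
  by rewrite EFinD !fineK//; exact: fn.
rewrite !lee_fin; lra.
Qed.

Lemma wpa1_sub (A B : nat -> set Om) :
  (\forall n \near \oo, A n `<=` B n) -> wpa1 P A -> wpa1 P B.
Proof.
move=> AB hA e e0; near=> n; apply: (@prob_ge_sub (A n)); first by near: n; exact: AB.
by near: n; exact: hA.
Unshelve. all: by end_near. Qed.

Lemma wpa1I (A B : nat -> set Om) :
  wpa1 P A -> wpa1 P B -> wpa1 P (fun n => A n `&` B n).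
Proof.
move=> hA hB e e0; near=> n; have -> : e = e / 2 + e / 2 by lra.
apply: prob_geI; near: n; [apply: hA|apply: hB]; lra.
Unshelve. all: by end_near. Qed.

(** The constant of a bounded-in-probability event depends on the probability
    level only; once the level is fixed it may be treated as a number, which is
    why [K] is universally quantified in the premise. *)
Lemma wpa1_bounded (A : R -> nat -> set Om) (B : nat -> set Om) :
  bounded_in_prob P A ->
  (forall K, wpa1 P (fun n => [set w | A K n w -> B n w])) -> wpa1 P B.
Proof.
move=> hA hB e e0.
have [|K AK] := hA (e / 2); first lra.
near=> n; have -> : e = e / 2 + e / 2 by lra.
apply: (@prob_ge_sub (A K n `&` [set w | A K n w -> B n w])).
  by move=> w [/= a]; exact.
apply: prob_geI; near: n; first exact: AK.
apply: hB; lra.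
Unshelve. all: by end_near. Qed.

Lemma bounded_in_probI (A B C : R -> nat -> set Om) :
  bounded_in_prob P A -> bounded_in_prob P B ->
  (forall K L, exists N, \forall n \near \oo, A K n `&` B L n `<=` C N n) ->
  bounded_in_prob P C.
Proof.
move=> hA hB hC e e0.
have [|K AK] := hA (e / 2); first lra.
have [|L BL] := hB (e / 2); first lra.
have [N CN] := hC K L; exists N; near=> n.
have -> : e = e / 2 + e / 2 by lra.
apply: (@prob_ge_sub (A K n `&` B L n)); first by near: n.
by apply: prob_geI; near: n.
Unshelve. all: by end_near. Qed.

Lemma wpa1_bounded_in_prob (A : nat -> set Om) :
  wpa1 P A -> bounded_in_prob P (fun=> A).
Proof. by move=> hA e e0; exists 0; exact: hA. Qed.

End prob_ge_theory.

(** * Slutsky's lemma for the normal law *)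

Section slutsky.
Context d (Om : measurableType d) (R : realType) (P : probability Om R).

(** The density is even; the reflection of the line exchanges the two half-lines. *)
Lemma normal_prob_symmetric (x : R) :
  normal_prob 0 1 [set y : R | y <= - x] = normal_prob 0 1 [set y : R | x <= y].
Proof.
have -> : [set y : R | y <= - x] = `]-oo, (- x)]%classic.
  by apply/seteqP; split => y /=; rewrite in_itv.
have -> : [set y : R | x <= y] = `[x, +oo[%classic.
  by apply/seteqP; split => y /=; rewrite in_itv/= andbT.
rewrite /normal_prob ge0_integration_by_substitutionNy; last 2 first.
- apply: continuous_subspaceT; exact: continuous_normal_pdf.
- by move=> y _; exact: normal_pdf_ge0.
apply: eq_integral => y _ /=; congr (_ %:E).
by rewrite !normal_pdfE// /normal_fun !subr0 sqrrN.
Qed.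

Lemma normal_prob_itv_le (x e : R) : 0 <= e ->
  (normal_prob 0%R 1%R `]x, (x + e)%R]%classic <= (normal_peak 1 * e)%R%:E :> \bar R)%E.
Proof.
move=> e0; rewrite /normal_prob; apply: le_trans.
  apply: (@ge0_le_integral _ _ _ _ _ _ _ (cst (normal_peak (1%R : R))%:E)) => //=.
  - by move=> y _; rewrite lee_fin normal_pdf_ge0.
  - apply/measurable_funTS/measurableT_comp => //; exact: measurable_normal_pdf.
  - by move=> y _; rewrite lee_fin normal_pdf_ub.
rewrite integral_cst//= lebesgue_measure_itv/= lte_fin.
case: ifP => h; last by rewrite mule0 lee_fin mulr_ge0// normal_peak_ge0.
by rewrite -EFinD -EFinM lee_fin addrAC subrr add0r.
Qed.

Definition normal_cdf (x : R) : R := fine (normal_prob 0 1 [set y : R | y <= x]).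

Lemma measurable_le_set (x : R) :
  measurable ([set y | y <= x] : set (measurableTypeR R)).
Proof.
have -> : [set y : R | y <= x] = `]-oo, x]%classic.
  by apply/seteqP; split => y /=; rewrite in_itv.
exact: measurable_itv.
Qed.

Lemma normal_cdfE x :
  (normal_prob 0 1 : probability (measurableTypeR R) R) [set y | y <= x] = (normal_cdf x)%:E.
Proof.
rewrite fineK// fin_num_measure//; exact: measurable_le_set.
Qed.

(** The density is bounded by its value at the mean, so the distribution
    function is Lipschitz; this quantitative continuity is what absorbs an
    [o_P(1)] perturbation in the proof of Slutsky's lemma. *)
Lemma normal_cdf_lip (x e : R) : 0 <= e ->
  normal_cdf x <= normal_cdf (x + e) <= normal_cdf x + normal_peak 1 * e.
Proof.
move=> e0.
have -> : normal_cdf (x + e) = normal_cdf x + fine (normal_prob 0 1 `]x, (x + e)]%classic).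
  rewrite /normal_cdf -fineD ?fin_num_measure//; last exact: measurable_le_set.
  rewrite -measureU//; last 2 first.
  - exact: measurable_le_set.
  - by apply/seteqP; split => // y [/= h]; rewrite in_itv/= => /andP[]; rewrite ltNge h.
  congr (fine (normal_prob _ _ _)); apply/seteqP; split => y /=; rewrite in_itv/=.
    by move=> yxe; case: (leP y x) => h; [left|right].
  by case => [h|/andP[]//]; apply: le_trans h _; rewrite lerDl.
rewrite lerDl lerD2l fine_ge0//= -lee_fin fineK ?normal_prob_itv_le//.
by rewrite fin_num_measure.
Qed.

Lemma normal_prob_set1 x : normal_prob 0 1 [set x] = 0%E :> \bar R.
Proof.
have : normal_prob 0 1 `<< (@lebesgue_measure R) by exact: normal_prob_dominates.
move/null_content_dominatesP; apply => //; exact: lebesgue_measure_set1.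
Qed.

Lemma normal_cdfN x : normal_cdf (- x) = 1 - normal_cdf x.
Proof.
rewrite /normal_cdf normal_prob_symmetric.
have -> : [set y : R | x <= y] = ~` [set y : R | y < x].
  apply/seteqP; split => y /=; last by move/negP; rewrite -leNgt.
  by move=> h; apply/negP; rewrite -leNgt.
have ml : measurable ([set y : R | y < x] : set (measurableTypeR R)).
  have -> : [set y : R | y < x] = `]-oo, x[%classic.
    by apply/seteqP; split => y /=; rewrite in_itv.
  exact: measurable_itv.
rewrite (@probability_setC _ _ R (normal_prob 0 1))//.
rewrite fineB ?fin_num_measure//=; congr (1 - fine _).
have -> : [set y : R | y <= x] = [set y | y < x] `|` [set x].
  apply/seteqP; split => y /=; rewrite le_eqVlt.
    by move=> /orP[/eqP ->|]; [right|left].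
  by case => [->|->]; rewrite ?orbT// eqxx.
rewrite (@measureU _ _ _ (normal_prob 0 1))//.
  by rewrite [X in (_ + X)%E](_ : _ = 0%E) ?adde0//; exact: normal_prob_set1.
by apply/seteqP; split => // y [/= + e]; rewrite e ltxx.
Qed.

(** The normal law has no atoms, hence its distribution function constrains
    the limit at every point. *)
Lemma cvg_in_law_normal (X : nat -> Om -> R) :
  cvg_in_law P X (normal_prob 0 1) <->
  (forall n, measurable_fun setT (X n)) /\
  forall x (e : R), 0 < e -> \forall n \near \oo,
     `|fine (P [set w | X n w <= x]) - normal_cdf x| <= e.
Proof.
have mX n x : measurable_fun setT (X n) -> measurable [set w | X n w <= x].
  move=> mX; have := mX measurableT _ (measurable_le_set x).
  by rewrite setTI.
split=> -[h1 h2]; split => // x.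
  move=> e e0.
  have := h2 x (normal_prob_set1 x).
  rewrite normal_cdfE => /fine_cvgP[_ /cvgrPdist_le /(_ e e0)].
  by apply: filterS => n /=; rewrite distrC.
move=> _; rewrite normal_cdfE; apply/fine_cvgP; split.
  by apply: nearW => n; rewrite fin_num_measure//; exact: mX.
apply/cvgrPdist_le => e e0; have := h2 x e e0.
by apply: filterS => n /=; rewrite distrC.
Qed.

(** Slutsky's lemma together with the symmetry of the normal law. Outside an
    event of small probability, [T <= x] is squeezed between
    [W > - x + s] and [W > - x - 2 * s]; the complements of these events are
    sublevel sets of [W], where convergence in law applies. *)
Lemma cvg_in_law_oppD_oP1 (T W : nat -> Om -> R) :
  (forall n, measurable_fun setT (T n)) ->
  cvg_in_law P W (normal_prob 0 1) ->
  oP1 P (fun n w => T n w - - W n w) ->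
  cvg_in_law P T (normal_prob 0 1).
Proof.
move=> mT /cvg_in_law_normal[mW cW] oTW; apply/cvg_in_law_normal; split => // x e e0.
have mle (X : nat -> Om -> R) n y :
    measurable_fun setT (X n) -> measurable [set w | X n w <= y].
  by move=> mX; have := mX measurableT _ (measurable_le_set y); rewrite setTI.
pose c : R := normal_peak 1; have c0 : 0 <= c by exact: normal_peak_ge0.
(* normal_cdf moves by at most 2 * (c * s) <= e / 2 over an interval of length 2 * s *)
pose s : R := e / (4%:R * (c + 1)).
have s0 : 0 < s by rewrite divr_gt0// mulr_gt0//; lra.
have cs : 2 * (c * s) <= e / 2.
  have -> : e / 2 = 2 * ((c + 1) * s) by rewrite /s; field; lra.
  by rewrite ler_pM2l// ler_pM2r//; lra.
have e4 : 0 < e / 4 by lra.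
near=> n.
have [G [mG GT PG]] : prob_ge P [set w | `|T n w - - W n w| <= s] (1 - e / 4).
  by near: n; exact: oTW.
have W1 : `|fine (P [set w | W n w <= - x - 2 * s]) - normal_cdf (- x - 2 * s)| <= e / 4.
  by near: n; exact: cW.
have W2 : `|fine (P [set w | W n w <= - x + s]) - normal_cdf (- x + s)| <= e / 4.
  by near: n; exact: cW.
have PGc : fine (P (~` G)) <= e / 4.
  rewrite probability_setC// fineB ?fin_num_measure//=.
  move: PG; have /fineK <- : P G \is a fin_num by exact: fin_num_measure.
  by rewrite lee_fin; lra.
have fineU (A B : set Om) : measurable A -> measurable B ->
    fine (P (A `|` B)) <= fine (P A) + fine (P B).
  move=> mA mB; rewrite -fineD ?fin_num_measure//.
  rewrite fine_le ?fin_numD ?fin_num_measure//; first exact: measurableU.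
  exact: measureU2.
have fineS (A B : set Om) : measurable A -> measurable B -> A `<=` B ->
    fine (P A) <= fine (P B).
  move=> mA mB AB; rewrite fine_le ?fin_num_measure// le_measure ?inE//.
have fineC (A : set Om) : measurable A -> fine (P (~` A)) = 1 - fine (P A).
  by move=> mA; rewrite probability_setC// fineB ?fin_num_measure.
have U : fine (P [set w | T n w <= x]) <=
    1 - fine (P [set w | W n w <= - x - 2 * s]) + fine (P (~` G)).
  rewrite -fineC; last exact: mle.
  apply: le_trans (fineU _ _ _ _); [|exact/measurableC/mle|exact: measurableC].
  apply: fineS; [exact: mle| |].
    by apply: measurableU; apply: measurableC => //; exact: mle.
  move=> w /= Tx; case: (pselect (G w)) => [/GT/= h|]; last by right.
  left; apply/negP; rewrite -ltNge; move: h; rewrite ler_norml => /andP[]; lra.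
have L : 1 - fine (P [set w | W n w <= - x + s]) <=
    fine (P [set w | T n w <= x]) + fine (P (~` G)).
  rewrite -fineC; last exact: mle.
  apply: le_trans (fineU _ _ _ _); [|exact/mle|exact: measurableC].
  apply: fineS; [exact/measurableC/mle| |].
    by apply: measurableU; [exact: mle|exact: measurableC].
  move=> w /= /negP; rewrite -ltNge => Wx.
  case: (pselect (G w)) => [/GT/= h|]; last by right.
  left; move: h; rewrite ler_norml => /andP[]; lra.
have P1 : normal_cdf (- x - 2 * s) = 1 - normal_cdf (x + 2 * s).
  by rewrite -normal_cdfN; congr normal_cdf; lra.
have P2 : normal_cdf (- x + s) = 1 - normal_cdf (x - s).
  by rewrite -normal_cdfN; congr normal_cdf; lra.
have s20 : 0 <= 2 * s by rewrite mulr_ge0 ?ler0n ?ltW.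
have /andP[_ ] := normal_cdf_lip x s20.
have /andP[_ ] := normal_cdf_lip (x - s) (ltW s0); rewrite subrK -/c.
move: W1 W2; rewrite P1 P2 !ler_norml => /andP[? ?] /andP[? ?] L1 L2.
have c2 : c * (2 * s) = 2 * (c * s) by ring.
have cs0 : 0 <= c * s by rewrite mulr_ge0 // ltW.
apply/andP; split; lra.
Unshelve. all: by end_near. Qed.

End slutsky.

(** * Quadratic forms and eigenvalues *)

Section quadratic_forms.
Context (R : realType).

(** The minimum over [t] of the quadratic is negative unless its linear
    coefficient vanishes; [- b / (a + 1)] is a decreasing step that does not
    require [a != 0]. *)
Lemma linear_coef_eq0 (a b : R) :
  0 <= a -> (forall t, 0 <= 2 * t * b + t ^+ 2 * a) -> b = 0.
Proof.
move=> a0 h; apply/eqP/negPn/negP => bn0.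
have b2 : 0 < b ^+ 2 by rewrite exprn_even_gt0.
have := h (- b / (a + 1)).
have -> : 2 * (- b / (a + 1)) * b + (- b / (a + 1)) ^+ 2 * a =
    - (b ^+ 2 * ((a + 2) / (a + 1) ^+ 2)) by field; lra.
rewrite oppr_ge0 leNgt mulr_gt0// divr_gt0//; first lra.
by rewrite exprn_gt0//; lra.
Qed.

Context (n : nat).
Implicit Types (S T : 'M[R]_n) (u v w : 'rV[R]_n).

Lemma qformE S u w : qform S u w = \sum_j (\sum_i u 0 i * S i j) * w 0 j.
Proof. by rewrite /qform mxE; apply: eq_bigr => j _; rewrite !mxE. Qed.

Lemma qformDl S u v w : qform S (u + v) w = qform S u w + qform S v w.
Proof. by rewrite /qform !mulmxDl mxE. Qed.

Lemma qformZl S a v w : qform S (a *: v) w = a * qform S v w.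
Proof. by rewrite /qform -!scalemxAl mxE. Qed.

Lemma qformDr S u v w : qform S u (v + w) = qform S u v + qform S u w.
Proof. by rewrite /qform linearD/= mulmxDr mxE. Qed.

Lemma qformZr S a v w : qform S v (a *: w) = a * qform S v w.
Proof. by rewrite /qform linearZ/= -scalemxAr mxE. Qed.

Lemma qformC S u w : S^T = S -> qform S u w = qform S w u.
Proof.
move=> Ss; rewrite /qform -[in RHS](trmxK (w *m S *m u^T)) [in RHS]mxE.
by rewrite !trmx_mul trmxK Ss mulmxA.
Qed.

Lemma qform_sqD S a u v : S^T = S ->
  qform S (u + a *: v) (u + a *: v) =
  qform S u u + 2 * a * qform S u v + a ^+ 2 * qform S v v.
Proof.
move=> Ss; rewrite !qformDl !qformDr !qformZl !qformZr (qformC v u Ss); ring.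
Qed.

Lemma qform_subsc S c u w :
  qform (S - c%:M) u w = qform S u w - c * qform 1%:M u w.
Proof.
rewrite /qform mulmxBr mulmxBl [in LHS]mxE; congr (_ + _).
by rewrite mulmx1 mul_mx_scalar -scalemxAl mxE mxE.
Qed.

Lemma qform1E u : qform 1%:M u u = \sum_j u 0 j ^+ 2.
Proof. by rewrite /qform mulmx1 mxE; apply: eq_bigr => j _; rewrite mxE expr2. Qed.

Lemma qform1_ge0 u : 0 <= qform 1%:M u u.
Proof. by rewrite qform1E; apply: sumr_ge0 => j _; exact: sqr_ge0. Qed.

Lemma qform1_eq0 u : (qform 1%:M u u == 0) = (u == 0).
Proof.
rewrite qform1E psumr_eq0; last by move=> j _; exact: sqr_ge0.
apply/allP/eqP => [h|-> j _]; last by rewrite /= mxE expr0n eqxx.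
apply/rowP => j; rewrite mxE; have := h j (mem_index_enum _).
by rewrite /= sqrf_eq0 => /eqP.
Qed.

(** An isotropic vector minimizes the form, so the first variation [u *m S]
    vanishes. *)
Lemma psd_qform_eq0 S u : S^T = S -> (forall v, 0 <= qform S v v) ->
  qform S u u = 0 -> u *m S = 0.
Proof.
move=> Ss S0 Su; apply/eqP; rewrite -qform1_eq0; apply/eqP.
rewrite (_ : qform _ _ _ = qform S u (u *m S)); last by rewrite /qform mulmx1.
apply: (@linear_coef_eq0 (qform S (u *m S) (u *m S))) => // t.
by have := S0 (u + t *: (u *m S)); rewrite qform_sqD// Su add0r.
Qed.

Lemma continuous_qform S : continuous (fun u => qform S u u).
Proof.
have -> : (fun u => qform S u u) =
    (fun u => \sum_j (\sum_i u 0 i * S i j) * u 0 j).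
  by apply/funext => u; exact: qformE.
have cC i : continuous (fun u : 'rV[R]_n => u 0 i) by exact: coord_continuous.
apply: (continuous_big add_continuous) => j _ u.
apply: (@continuousM _ _ (fun u : 'rV[R]_n => \sum_i u 0 i * S i j)) => //; last exact: cC.
apply: (continuous_big add_continuous) => i _ v.
by apply: (@continuousM _ _ (fun u : 'rV[R]_n => u 0 i));
  [exact: cC|exact: cst_continuous].
Qed.

End quadratic_forms.

(** Rayleigh's principle. The quotient attains its minimum [l] on the compact
    unit sphere; then [S - l%:M] is positive semidefinite and isotropic at the
    minimizer, which is therefore an eigenvector for [l]. *)
Lemma eigenvalue_ge_qform (R : realType) (n : nat) (S : 'M[R]_n) (c : R) :
  S^T = S -> (forall l, eigenvalue S l -> c <= l) ->
  forall u, c * qform 1%:M u u <= qform S u u.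
Proof.
case: n S => [|n] S Ss ev.
  by move=> u; rewrite (thinmx0 u) /qform !mul0mx mxE mulr0.
pose C := [set u : 'rV[R]_n.+1 | qform 1%:M u u = 1].
have C0 : C !=set0.
  exists (delta_mx 0 0); rewrite /C/= qform1E (bigD1 ord0)//= big1 ?addr0.
    by rewrite mxE !eqxx expr1n.
  by move=> j /negbTE j0; rewrite mxE j0 andbF expr0n.
have cC : compact C.
  apply: bounded_closed_compact.
    exists 1; split; first exact: num_real.
    move=> M M1 u; rewrite /C/= qform1E => u1.
    rewrite [leLHS]/Num.norm/= mx_normrE; apply/bigmax_leP; split; first by lra.
    move=> [i j] _ /=; rewrite (ord1 i) -ler_sqr ?nnegrE//; last lra.
    rewrite real_normK ?num_real//.
    apply: (@le_trans _ _ 1); last by apply: exprn_ege1; exact: ltW.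
    rewrite -u1 (bigD1 j)//= lerDl; apply: sumr_ge0 => k _; exact: sqr_ge0.
  rewrite (_ : C = (fun u => qform 1%:M u u) @^-1` [set 1]); last by [].
  apply: (closed_comp (fun u _ => @continuous_qform _ _ 1%:M u)).
  exact: closed_eq.
have [u0 /[!inE] u01 umin] := compact_EVT_min C0 cC
  (continuous_subspaceT (@continuous_qform _ _ S)).
pose l := qform S u0 u0.
have lS v : l * qform 1%:M v v <= qform S v v.
  have [->|v0] := eqVneq v 0.
    by rewrite -(scale0r (0 : 'rV[R]_n.+1)) !qformZl !mul0r mulr0.
  have N0 : 0 < qform 1%:M v v by rewrite lt_neqAle qform1_ge0 eq_sym qform1_eq0 v0.
  pose k := (Num.sqrt (qform 1%:M v v))^-1.
  have k2 : k ^+ 2 = (qform 1%:M v v)^-1 by rewrite exprVn sqr_sqrtr// ltW.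
  have : (k *: v) \in C.
    by rewrite inE /C/= qformZl qformZr mulrA -expr2 k2 mulVf// gt_eqF.
  move/umin; rewrite -/l qformZl qformZr mulrA -expr2 k2 mulrC.
  by rewrite ler_pdivlMr.
have TE u v : qform (S - l%:M) u v = qform S u v - l * qform 1%:M u v.
  exact: qform_subsc.
have el : eigenvalue S l.
  apply/eigenvalueP; exists u0; last by rewrite -qform1_eq0 u01 oner_neq0.
  apply/eqP; rewrite -subr_eq0 -mul_mx_scalar -mulmxBr; apply/eqP.
  apply: psd_qform_eq0.
  - by rewrite linearB/= Ss tr_scalar_mx.
  - by move=> v; rewrite TE subr_ge0.
  - by rewrite TE u01 mulr1 subrr.
move=> u; apply: le_trans (lS u); rewrite ler_wpM2r ?qform1_ge0//.
exact: ev.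
Qed.

Lemma eigenvalue_le_qform (R : realType) (n : nat) (S : 'M[R]_n) (c : R) :
  S^T = S -> (forall l, eigenvalue S l -> l <= c) ->
  forall u, qform S u u <= c * qform 1%:M u u.
Proof.
move=> Ss ev u.
have qN : qform (- S) u u = - qform S u u by rewrite /qform mulmxN mulNmx mxE.
rewrite -lerN2 -qN -mulNr; apply: eigenvalue_ge_qform; first by rewrite linearN/= Ss.
move=> l /eigenvalueP[v vl v0]; rewrite lerNl; apply: ev.
by apply/eigenvalueP; exists v => //; rewrite scaleNr -vl mulmxN opprK.
Qed.

Section inverse_form.
Context (R : realType) (n : nat) (S : 'M[R]_n).
Hypothesis Spd : sym_posdef S.

Lemma sym_posdef_unit : S \in unitmx.
Proof.
rewrite unitmxE unitfE; apply/negP => /det0P[v v0 vS].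
by have := Spd.2 v v0; rewrite /qform vS mul0mx mxE ltxx.
Qed.

Lemma invmx_sym : (invmx S)^T = invmx S.
Proof. by rewrite trmx_inv Spd.1. Qed.

Lemma qform_invE u : qform (invmx S) u u = qform S (u *m invmx S) (u *m invmx S).
Proof.
by rewrite /qform trmx_mul invmx_sym mulmxKV ?sym_posdef_unit// mulmxA.
Qed.

Lemma qform_inv_ge0 u : 0 <= qform (invmx S) u u.
Proof.
rewrite qform_invE; have [->|/Spd.2 /ltW//] := eqVneq (u *m invmx S) 0.
by rewrite /qform mul0mx mul0mx mxE.
Qed.

Lemma qform_inv_eq0 u : qform (invmx S) u u = 0 -> u = 0.
Proof.
rewrite qform_invE; have [h _|/Spd.2 /[swap] ->] := eqVneq (u *m invmx S) 0;
  last by rewrite ltxx.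
by rewrite -[u](mulmxKV sym_posdef_unit) h mul0mx.
Qed.

(** Expanding [0 <= |u - c w|^2] with [w] the image of [u] under the inverse,
    and using [c |w|^2 <= w S w^T = u S^-1 u^T]. *)
Lemma qform_inv_le c u : 0 < c -> (forall l, eigenvalue S l -> c <= l) ->
  qform (invmx S) u u <= c^-1 * qform 1%:M u u.
Proof.
move=> c0 /(eigenvalue_ge_qform Spd.1) /(_ (u *m invmx S)).
rewrite -qform_invE; set w := u *m invmx S; set q := qform _ u u => h.
have uw : qform 1%:M u w = q.
  by rewrite /w /q /qform mulmx1 trmx_mul invmx_sym mulmxA.
have := @qform1_ge0 _ _ (u + (- c) *: w); rewrite qform_sqD ?trmx1// uw.
have : c * (c * qform 1%:M w w) <= c * q by rewrite ler_pM2l.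
rewrite ler_pdivlMl// => h1 h2.
have -> : c * q = 2 * (c * q) - c * q by lra.
have e : qform 1%:M u u + 2 * - c * q + (- c) ^+ 2 * qform 1%:M w w =
   qform 1%:M u u - 2 * (c * q) + c * (c * qform 1%:M w w) by ring.
rewrite e in h2; lra.
Qed.

(** Polarization of the previous bound; it dominates the integrand of the
    weighted inner product by squares. *)
Lemma norm_qform_inv_le c u w : 0 < c -> (forall l, eigenvalue S l -> c <= l) ->
  `|qform (invmx S) u w| <= c^-1 * (qform 1%:M u u + qform 1%:M w w).
Proof.
move=> c0 ev; have hu := qform_inv_le u c0 ev; have hw := qform_inv_le w c0 ev.
have := qform_inv_ge0 (u + 1 *: w); have := qform_inv_ge0 (u + (- 1) *: w).
rewrite !qform_sqD ?invmx_sym// sqrrN expr1n !mul1r !mulr1 => h1 h2.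
have := qform_inv_ge0 u; have := qform_inv_ge0 w.
by rewrite mulrDr ler_norml => ? ?; apply/andP; split; lra.
Qed.

End inverse_form.

(** * Measurability and almost sure statements *)

Section measurability.
Context d (T : measurableType d) (R : realType).

Lemma measurable_invr : measurable_fun setT (@GRing.inv R).
Proof.
have -> : @GRing.inv R = fun x => if x == 0 then 0 else x^-1.
  by apply/funext => x; case: eqP => // ->; rewrite invr0.
apply: measurable_fun_if => //.
  exact: measurable_fun_eqr.
rewrite setTI (_ : _ @^-1` _ = ~` [set 0]); last first.
  apply/seteqP; split => x /=; first by move=> + x0; rewrite x0 eqxx.
  by move=> /eqP/negbTE.
apply: open_continuous_measurable_fun; first exact/closed_openC/closed_eq.
by move=> x; rewrite inE/= => /eqP x0; exact: inv_continuous.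
Qed.

Lemma measurable_det n (A : T -> 'M[R]_n) :
  (forall i j, measurable_fun setT (fun x => A x i j)) ->
  measurable_fun setT (fun x => \det (A x)).
Proof.
move=> mA; rewrite /determinant.
apply: measurable_sum => s; apply: measurable_funM => //.
by apply: measurable_prod.
Qed.

(** Cramer's rule, with the convention [invmx A = A] off the unit group. *)
Lemma measurable_invmx n (A : T -> 'M[R]_n) :
  (forall i j, measurable_fun setT (fun x => A x i j)) ->
  forall i j, measurable_fun setT (fun x => invmx (A x) i j).
Proof.
move=> mA i j; have mD := measurable_det mA.
have -> : (fun x => invmx (A x) i j) =
    (fun x => if \det (A x) == 0 then A x i j
              else (\det (A x))^-1 * \adj (A x) i j).
  apply/funext => x; rewrite /invmx unitmxE unitfE.
  by case: eqP => //= _; rewrite mxE.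
apply: measurable_fun_ifT => //; first exact: measurable_fun_eqr.
apply: measurable_funM; first exact: (measurableT_comp measurable_invr).
have -> : (fun x => \adj (A x) i j) = (fun x => cofactor (A x) j i).
  by apply/funext => x; rewrite mxE.
apply: measurable_funM => //; apply: measurable_det => k l.
by under eq_fun do rewrite !mxE; exact: mA.
Qed.

Lemma measurable_qform n (A : T -> 'M[R]_n) (u w : T -> 'rV[R]_n) :
  (forall i j, measurable_fun setT (fun x => A x i j)) ->
  (forall j, measurable_fun setT (fun x => u x 0 j)) ->
  (forall j, measurable_fun setT (fun x => w x 0 j)) ->
  measurable_fun setT (fun x => qform (A x) (u x) (w x)).
Proof.
move=> mA mu mw; under eq_fun do rewrite qformE.
apply: measurable_sum => j; apply: measurable_funM => //.
by apply: measurable_sum => i; exact: measurable_funM.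
Qed.

Lemma measurable_mulmx m n p (A : T -> 'M[R]_(m, n)) (B : T -> 'M[R]_(n, p)) :
  (forall i j, measurable_fun setT (fun x => A x i j)) ->
  (forall i j, measurable_fun setT (fun x => B x i j)) ->
  forall i j, measurable_fun setT (fun x => (A x *m B x) i j).
Proof.
move=> mA mB i j; under eq_fun do rewrite mxE.
by apply: measurable_sum => k; exact: measurable_funM.
Qed.

End measurability.

Section almost_everywhere_implications.
Context d (T : measurableType d) (R : realType).
Variable mu : {measure set T -> \bar R}.
Implicit Types A B C : T -> Prop.

Lemma ae_imply A B : {ae mu, forall x, A x} -> (forall x, A x -> B x) ->
  {ae mu, forall x, B x}.
Proof. by move=> hA AB; apply: filterS hA. Qed.

Lemma ae_imply2 A B C : {ae mu, forall x, A x} -> {ae mu, forall x, B x} ->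
  (forall x, A x -> B x -> C x) -> {ae mu, forall x, C x}.
Proof. by move=> hA hB ABC; apply: filterS2 hA hB. Qed.

Lemma ae_forall_fin (I : finType) (A : I -> T -> Prop) :
  (forall i, {ae mu, forall x, A i x}) -> {ae mu, forall x, forall i, A i x}.
Proof. by move=> hA; apply: filter_forall. Qed.

End almost_everywhere_implications.

Section ae_integrals.
Context d (T : measurableType d) (R : realType).
Variable mu : {measure set T -> \bar R}.

Lemma ae_dominated_integrable (f g : T -> R) :
  measurable_fun setT f -> mu.-integrable setT (EFin \o g) ->
  {ae mu, forall x, `|f x| <= g x} -> mu.-integrable setT (EFin \o f).
Proof.
move=> mf /integrableP[mg gfin] fg; apply/integrableP; split; first exact/measurable_EFinP.
apply: le_lt_trans gfin; apply: ae_ge0_le_integral => //.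
- by do 2 apply: measurableT_comp => //.
- by apply: measurableT_comp.
- by move: fg; apply: filterS => x fg _ /=; rewrite lee_fin (le_trans fg)// ler_norm.
Qed.

Lemma ae_eq_Rintegral (f g : T -> R) :
  measurable_fun setT f -> measurable_fun setT g ->
  {ae mu, forall x, f x = g x} -> \int[mu]_x f x = \int[mu]_x g x.
Proof.
move=> mf mg fg; rewrite /Rintegral; congr fine; apply: ae_eq_integral => //.
- exact/measurable_EFinP.
- exact/measurable_EFinP.
- by move: fg; apply: filterS => x /= -> .
Qed.

Lemma ae_le_Rintegral (f g : T -> R) :
  measurable_fun setT f -> mu.-integrable setT (EFin \o g) ->
  {ae mu, forall x, 0 <= f x <= g x} -> \int[mu]_x f x <= \int[mu]_x g x.
Proof.
move=> mf ig fg; have /integrableP[/measurable_EFinP mg gfin] := ig.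
(* truncating f at g gives a pointwise inequality between integrable functions *)
have -> : \int[mu]_x f x = \int[mu]_x (Num.min (f x) (g x)).
  apply: ae_eq_Rintegral => //; first exact: measurable_minr.
  by move: fg; apply: filterS => x /andP[_ fg]; rewrite min_l.
apply: le_Rintegral => // [|x _]; last by rewrite ge_min lexx orbT.
apply: ae_dominated_integrable ig _; first exact: measurable_minr.
by move: fg; apply: filterS => x /andP[f0 fg]; rewrite min_l// ger0_norm.
Qed.

End ae_integrals.

Section observations.
Context (R : realType) (dy dx : nat) (PZ : probability (obs R dy dx) R).
Local Notation ZT := (obs R dy dx).
Local Notation XT := (borel_rV R dx).

Lemma open_measurable_snd (U : set 'rV[R]_dx) : open U ->
  measurable ([set z | U z.2] : set ZT).
Proof.
move=> oU; have := @measurable_snd _ _ (borel_rV R dy) XT measurableT.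
move=> /(_ U); rewrite setTI; apply; exact: sub_gen_smallest.
Qed.

Lemma measurable_fun_X (f : XT -> R) : measurable_fun setT f ->
  measurable_fun setT (fun z : ZT => f z.2).
Proof. by move=> mf; exact: (measurableT_comp mf measurable_snd). Qed.

(** Second countability: a point off the support lies in a null ball with
    rational centre and radius [1 / k.+1], and there are countably many such
    balls. *)
Lemma ae_supportX : {ae PZ, forall z, supportX PZ z.2}.
Proof.
pose B (p : 'rV[rat]_dx * nat) : set 'rV[R]_dx :=
  ball (map_mx ratr p.1 : 'rV[R]_dx) (p.2.+1%:R^-1).
have oB p : open (B p) by exact: ball_open.
pose N k := if unpickle k is Some p then
  (if PZ [set z | B p z.2] == 0%E then [set z : ZT | B p z.2] else set0)
  else set0.
apply: (@negligibleS _ _ _ _ (\bigcup_k N k)); last first.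
  apply: negligible_bigcup => k; rewrite /N.
  case: unpickle => [p|]; last exact: negligible_set0.
  case: eqP => [h|_]; last exact: negligible_set0.
  apply/negligibleP => //; exact: open_measurable_snd.
move=> z /= /existsNP[U /not_implyP[oU /not_implyP[Uz]]].
move/negP; rewrite -leNgt measure_le0 => /eqP PU.
have /nbhs_ballP[e e0 eU] : nbhs z.2 U by exact: open_nbhs_nbhs.
pose k := Num.truncn (2 / e).
have ke : k.+1%:R^-1 < e / 2.
  rewrite -[ltRHS]invf_div ltf_pV2 ?posrE ?divr_gt0//.
  exact: truncnS_gt.
have k0 : 0 < k.+1%:R^-1 :> R by rewrite invr_gt0.
have ratd (x e1 : R) : 0 < e1 -> exists q : rat, `|x - ratr q| < e1.
  move=> e10; have [|q] := @rat_in_itvoo R (x - e1) (x + e1); first by lra.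
  by rewrite in_itv/= => /andP[h1 h2]; exists q; rewrite ltr_norml; apply/andP; split; lra.
have qex j : exists q : rat, `|z.2 0 j - ratr q| < k.+1%:R^-1 by exact: ratd.
have [q qP] := choice qex.
pose p := ((\row_j q j, k) : 'rV[rat]_dx * nat).
have Bz : B p z.2.
  split => // i j; rewrite !mxE (ord1 i) /ball/= distrC; exact: qP.
have PB : PZ [set z | B p z.2] = 0%E.
  apply/eqP; rewrite -measure_le0 -PU le_measure ?inE//.
  - exact: open_measurable_snd.
  - exact: open_measurable_snd.
  - move=> y /= By; apply: eU.
    apply: (@ball_split _ _ (map_mx ratr p.1 : 'rV[R]_dx)).
      by apply: ball_sym; apply: le_ball Bz; exact: ltW.
    by apply: le_ball By; exact: ltW.
by exists (pickle p) => //=; rewrite /N pickleK PB eqxx.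
Qed.

(** Both versions integrate to the same value over the sigma(X)-measurable event
    where one exceeds the other, which is therefore null. *)
Lemma cond_exp_unique (f : ZT -> R) (g1 g2 : XT -> R) :
  is_cond_exp PZ f g1 -> is_cond_exp PZ f g2 ->
  {ae PZ, forall z, g1 z.2 = g2 z.2}.
Proof.
move=> [fi mg1 fg1] [_ mg2 fg2].
have gi g : measurable_fun setT g ->
  (forall B : set XT, measurable B ->
        (\int[PZ]_(z in snd @^-1` B) (g z.2)%:E =
         \int[PZ]_(z in snd @^-1` B) (f z)%:E)%E) ->
  PZ.-integrable setT (EFin \o (fun z => g z.2)).
  move=> mg /(_ setT measurableT); rewrite preimage_setT => fg.
  have mg' : measurable_fun setT (EFin \o (fun z : ZT => g z.2)).
    apply/measurable_EFinP; exact: measurable_fun_X.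
  apply/integrableP; split => //; apply/abse_integralP => //.
  rewrite [X in `|X|%E]fg; apply/abse_integralP => //; by case/integrableP: fi.
have i1 := gi _ mg1 fg1; have i2 := gi _ mg2 fg2.
have half (g h : XT -> R) : measurable_fun setT g -> measurable_fun setT h ->
   PZ.-integrable setT (EFin \o (fun z => g z.2)) ->
   PZ.-integrable setT (EFin \o (fun z => h z.2)) ->
   (forall B : set XT, measurable B -> (\int[PZ]_(z in snd @^-1` B) (g z.2)%:E =
         \int[PZ]_(z in snd @^-1` B) (h z.2)%:E)%E) ->
   {ae PZ, forall z, g z.2 <= h z.2}.
  move=> mg mh ig ih gh.
  pose B := [set x | h x < g x].
  have mB : measurable (B : set XT).
    have := @measurable_fun_ltr _ _ _ _ _ _ mh mg measurableT [set true].
    by rewrite setTI; exact.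
  have mE : measurable (snd @^-1` B : set ZT).
    by have := @measurable_snd _ _ (borel_rV R dy) XT measurableT B mB; rewrite setTI.
  have igE := integrableS measurableT mE (@subsetT _ _) ig.
  have ihE := integrableS measurableT mE (@subsetT _ _) ih.
  have : (\int[PZ]_(z in snd @^-1` B) `|(g z.2)%:E - (h z.2)%:E| = 0)%E.
    rewrite -[RHS](subee (integrable_fin_num mE igE)) [in X in (_ - X)%E]gh//.
    rewrite -integralB_EFin//; apply: eq_integral => z /[!inE] Bz.
    by rewrite gee0_abs// -EFinB lee_fin subr_ge0 ltW.
  have mgh : measurable_fun (snd @^-1` B) (fun z : ZT => (g z.2)%:E - (h z.2)%:E)%E.
    by apply: emeasurable_funB; [exact: measurable_int igE|exact: measurable_int ihE].
  move/(ae_eq_integral_abs PZ mE mgh); apply: filterS => z Ez.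
  rewrite leNgt; apply/negP => hg; have /eqP := Ez hg.
  by rewrite -EFinB eqe subr_eq0 gt_eqF.
have := half _ _ mg1 mg2 i1 i2; have := half _ _ mg2 mg1 i2 i1.
move=> h21 h12.
have {}h21 := h21 (fun B mB => etrans (fg2 B mB) (esym (fg1 B mB))).
have {}h12 := h12 (fun B mB => etrans (fg1 B mB) (esym (fg2 B mB))).
move: h12; apply: filterS2 h21 => z a b; apply/eqP; rewrite eq_le.
by rewrite a b.
Qed.

End observations.

(** * Semi-inner products and linear spans *)

Section semi_inner_product.
Context (R : realType) (E : lmodType R) (W : set E) (B : E -> E -> R).
Hypothesis WZD : forall c v w, W v -> W w -> W (c *: v + w).
Hypothesis BC : forall v w, W v -> W w -> B v w = B w v.
Hypothesis BZDl : forall c v w u, W v -> W w -> W u ->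
  B (c *: v + w) u = c * B v u + B w u.

Lemma semi_ip_sqZD t v w : W v -> W w ->
  B (t *: w + v) (t *: w + v) = B v v + 2 * t * B v w + t ^+ 2 * B w w.
Proof.
move=> Wv Ww; have Wt := WZD t Ww Wv.
rewrite (BZDl t Ww Wv Wt) (BC Ww Wt) (BC Wv Wt).
rewrite (BZDl t Ww Wv Ww) (BZDl t Ww Wv Wv) (BC Ww Wv); ring.
Qed.

Hypothesis B_ge0 : forall v, W v -> 0 <= B v v.

(** This replaces the triangle inequality for [N], whose sharper constant would
    be irrelevant to orders of magnitude. *)
Lemma semi_ip_parallelogram (N : E -> R) v w :
  (forall u, W u -> N u ^+ 2 = B u u) -> W v -> W w ->
  N (v - w) ^+ 2 <= 2 * (N v ^+ 2 + N w ^+ 2).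
Proof.
move=> NB Wv Ww; have := B_ge0 (WZD 1 Ww Wv).
have -> : v - w = (- 1) *: w + v by rewrite scaleN1r addrC.
rewrite (NB _ Wv) (NB _ Ww) (NB _ (WZD (-1) Ww Wv)) !semi_ip_sqZD//; lra.
Qed.

(** First-order condition of the projection: the minimizer is orthogonal to
    every direction of the space it minimizes over. *)
Lemma semi_ip_min_orth v w : W v -> W w ->
  (forall t, B v v <= B (t *: w + v) (t *: w + v)) -> B v w = 0.
Proof.
move=> Wv Ww h; apply: (linear_coef_eq0 (B_ge0 Ww)) => t.
by have := h t; rewrite semi_ip_sqZD// -addrA lerDl.
Qed.

End semi_inner_product.

Section span_theory.
Local Notation span := Defs.span.
Context (R : realType) (E : lmodType R).
Implicit Types (S : set E) (u v w : E).

Lemma sub_span S : S `<=` span S.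
Proof.
move=> v Sv; exists 1%N, (fun=> 1), (fun=> v); split => //.
by rewrite big_ord_recl big_ord0 addr0 scale1r.
Qed.

Lemma span_lin S c v w : span S v -> span S w -> span S (c *: v + w).
Proof.
move=> [n [a [x [Sx ->]]]] [m [b [y [Sy ->]]]].
exists (n + m)%N, (fun i => if (i < n)%N then c * a i else b (i - n)%N),
  (fun i => if (i < n)%N then x i else y (i - n)%N); split.
  move=> i inm; case: ifPn => [/Sx//|]; rewrite -leqNgt => ni.
  by apply: Sy; rewrite ltn_subLR.
rewrite big_split_ord/=; congr (_ + _).
  by rewrite scaler_sumr; apply: eq_bigr => i _; rewrite ltn_ord scalerA.
by apply: eq_bigr => i _; rewrite ltnNge leq_addr/= addKn.
Qed.

Lemma spanB S v w : span S v -> span S w -> span S (v - w).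
Proof. by move=> Sv Sw; rewrite addrC -scaleN1r; exact: span_lin. Qed.

Lemma span_min S (W : set E) : W 0 ->
  (forall c v w, W v -> W w -> W (c *: v + w)) -> S `<=` W -> span S `<=` W.
Proof.
move=> W0 Wlin SW v [n [c [u [Su ->]]]].
elim/big_ind : _ => //.
  by move=> x y Wx Wy; rewrite -[x]scale1r; exact: Wlin.
move=> i _; rewrite -[_ *: _]addr0; apply: Wlin => //; exact/SW/Su.
Qed.

(** Two vectors of a line satisfy the relation with swapped coefficients. *)
Lemma has_dim_span1_le1 (x : E) n : has_dim (span [set x]) n -> (n <= 1)%N.
Proof.
move=> [b [bfree bE]]; rewrite leqNgt; apply/negP => n1.
have mult v : span [set x] v -> exists c : R, v = c *: x.
  apply: (@span_min _ [set v | exists c : R, v = c *: x]).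
  - by exists 0; rewrite scale0r.
  - move=> c ? ? [a ->] [a' ->]; exists (c * a + a').
    by rewrite scalerA scalerDl.
  - by move=> ? ->; exists 1; rewrite scale1r.
have bV i : span [set x] (b i).
  rewrite bE; exists (fun j => (j == i)%:R).
  rewrite (bigD1 i)//= eqxx scale1r big1 ?addr0// => j /negbTE ->.
  by rewrite scale0r.
pose i0 := Ordinal (ltn_trans (ltn0Sn 0) n1); pose i1 := Ordinal n1.
have [c0 e0] := mult _ (bV i0); have [c1 e1] := mult _ (bV i1).
have pair (a0 a1 : R) : a0 *: b i0 + a1 *: b i1 = 0 -> a0 = 0 /\ a1 = 0.
  move=> h; have := bfree (fun j => if val j == 0%N then a0
                                    else if val j == 1%N then a1 else 0).
  rewrite (bigD1 i0)//= (bigD1 i1)//= big1 ?addr0 => [/(_ h) z|j].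
    by split; [exact: (z i0)|exact: (z i1)].
  by rewrite -!val_eqE /= => /andP[/negbTE -> /negbTE ->]; rewrite scale0r.
have [c10 c00] : c1 = 0 /\ - c0 = 0.
  by apply: pair; rewrite e0 e1 !scalerA mulNr mulrC -scalerDl subrr scale0r.
have := @pair 1 0; rewrite scale1r scale0r addr0 e0.
have -> : c0 = 0 by rewrite -[c0]opprK c00 oppr0.
by rewrite scale0r => /(_ erefl) [/eqP]; rewrite oner_eq0.
Qed.

End span_theory.

(** * The weighted inner product *)

Lemma derive_zero_dir (R : realType) (V W : normedModType R) (f : V -> W) (a : V) :
  derivable f a 0 /\ 'D_0 f a = 0.
Proof.
have e : (fun h : R => h^-1 *: (f (h *: 0 + a) - f a)) = cst 0.
  by apply/funext => h; rewrite scaler0 add0r subrr scaler0.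
split; last by rewrite /derive e lim_cst.
by apply/cvg_ex; exists 0; rewrite [X in X @ _](_ : _ = cst 0)//; exact: cvg_cst.
Qed.

Section weighted_inner_product.
Context (R : realType) (dy dx drho dth : nat) (H : completeNormedModType R).
Context (M : population dy dx drho dth H) (D : design dth H).
Hypotheses (hM : model_ok M) (hV : tangent_ok M D) (hID : cond_ID M D).

Local Notation PZ := (PZ M).
Local Notation alpha0 := (alpha0 M).
Local Notation md v z := (mdot M alpha0 z.2 v).
Local Notation qip v w := (fun z : obs R dy dx =>
  qform (invmx (Sigma M z.2)) (md v z) (md w z)).
Local Notation sq v := (fun z : obs R dy dx => qform 1%:M (md v z) (md v z)).
Local Notation qsd v := (fun z : obs R dy dx => qform
  (invmx (Sigma M z.2) *m Sigma0 M z.2 *m invmx (Sigma M z.2)) (md v z) (md v z)).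

Lemma Sigma_posdef_ae : {ae PZ, forall z, sym_posdef (Sigma M z.2)}.
Proof.
have [[_ [_ pd] _ _ _] _] := hM.
by apply: (ae_imply (ae_supportX PZ)) => z; exact: pd.
Qed.

(** The entries of [Sigma0] are versions of conditional expectations of products
    that are symmetric in the two indices, so they agree almost surely only. *)
Lemma Sigma0_sym_ae : {ae PZ, forall z, (Sigma0 M z.2)^T = Sigma0 M z.2}.
Proof.
have [[_ _ ce _ _] _] := hM.
have h (p : 'I_drho * 'I_drho) :
    {ae PZ, forall z, Sigma0 M z.2 p.1 p.2 = Sigma0 M z.2 p.2 p.1}.
  case: p => j l /=; have := ce l j.
  rewrite (_ : (fun z => _) = (fun z =>
      (rho M z alpha0 0 j - mu_ M z.2 alpha0 0 j) *
      (rho M z alpha0 0 l - mu_ M z.2 alpha0 0 l))) => [ce'|].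
    exact: (cond_exp_unique (ce j l) ce').
  by apply/funext => z; rewrite mulrC.
apply: (ae_imply (ae_forall_fin h)) => z hz.
by apply/matrixP => i j; rewrite mxE (hz (j, i)).
Qed.

Lemma Sigma_bounds : exists c1 c2 : R, [/\ 0 < c1, 0 < c2 &
  {ae PZ, forall z,
    (forall l, eigenvalue (Sigma M z.2) l -> c1 <= l <= c2) /\
    (forall l, eigenvalue (Sigma0 M z.2) l -> c1 <= l <= c2)}].
Proof.
have [_ _ _ [c1 [c2 [/andP[c10 c12] ev]]]] := hID.
exists c1, c2; split => //; first exact: lt_le_trans c12.
apply: (ae_imply (ae_supportX PZ)) => z /ev h.
by split => l el; apply: h; rewrite el ?orbT.
Qed.

Lemma measurable_Sigma i j : measurable_fun setT (fun z : obs R dy dx => Sigma M z.2 i j).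
Proof.
by have [[_ [mS _] _ _ _] _] := hM; exact: (measurable_fun_X (mS i j)).
Qed.

Lemma measurable_Sigma0 i j : measurable_fun setT (fun z : obs R dy dx => Sigma0 M z.2 i j).
Proof.
by have [[_ _ ce _ _] _] := hM; have [_ m _] := ce i j; exact: (measurable_fun_X m).
Qed.

Lemma measurable_mdot v j : diff_dir M v ->
  measurable_fun setT (fun z : obs R dy dx => md v z 0 j).
Proof. by move=> [_ /(_ j)] /[!inE] /andP[/[!inE]]. Qed.

Lemma integrable_sq v : diff_dir M v -> PZ.-integrable setT (EFin \o sq v).
Proof.
move=> [_ hv].
have -> : EFin \o sq v = (fun z : obs R dy dx => \sum_j ((md v z 0 j) ^+ 2)%:E)%E.
  by apply/funext => z /=; rewrite qform1E sumEFin.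
by apply: integrable_sum => // j _; exact: Lfun2_integrable_sqr.
Qed.

Lemma measurable_qip v w : diff_dir M v -> diff_dir M w -> measurable_fun setT (qip v w).
Proof.
move=> dv dw; apply: measurable_qform.
- exact: (measurable_invmx measurable_Sigma).
- by move=> j; exact: measurable_mdot.
- by move=> j; exact: measurable_mdot.
Qed.

Lemma measurable_qsd v : diff_dir M v -> measurable_fun setT (qsd v).
Proof.
move=> dv; apply: measurable_qform.
- have mI := measurable_invmx measurable_Sigma.
  apply: measurable_mulmx => // i j.
  by apply: measurable_mulmx => //; exact: measurable_Sigma0.
- by move=> j; exact: measurable_mdot.
- by move=> j; exact: measurable_mdot.
Qed.

(** The inverse weights are bounded, the directional derivatives square
    integrable. *)
Lemma integrable_qip v w : diff_dir M v -> diff_dir M w ->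
  PZ.-integrable setT (EFin \o qip v w).
Proof.
move=> dv dw; have [c1 [c2 [c10 _ ev]]] := Sigma_bounds.
apply: (@ae_dominated_integrable _ _ _ _ _ (fun z => c1^-1 * (sq v z + sq w z))).
- exact: measurable_qip.
- rewrite (_ : EFin \o _ = fun z : obs R dy dx =>
      c1^-1%:E * ((EFin \o sq v) \+ (EFin \o sq w)) z)%E; last first.
    by apply/funext => z /=; rewrite EFinM EFinD.
  by apply: integrableZl => //; apply: integrableD => //; exact: integrable_sq.
- apply: (ae_imply2 Sigma_posdef_ae ev) => z pd [{}ev _].
  by apply: norm_qform_inv_le => // l /ev /andP[].
Qed.

Lemma ipC v w : diff_dir M v -> diff_dir M w -> ip M v w = ip M w v.
Proof.
move=> dv dw; apply: ae_eq_Rintegral; [exact: measurable_qip|exact: measurable_qip|].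
by apply: (ae_imply Sigma_posdef_ae) => z pd; rewrite qformC// invmx_sym.
Qed.

Lemma Vbar_diff_dir v : Vbar M D v -> diff_dir M v.
Proof. by have [h _ _] := hV; exact: h. Qed.

Lemma VbarZD c v w : Vbar M D v -> Vbar M D w -> Vbar M D (c *: v + w).
Proof. by have [_ h _] := hV; exact: h. Qed.

Lemma ipZDl c v w u : Vbar M D v -> Vbar M D w -> Vbar M D u ->
  ip M (c *: v + w) u = c * ip M v u + ip M w u.
Proof.
move=> Vv Vw Vu.
have [dv dw du] : [/\ diff_dir M v, diff_dir M w & diff_dir M u].
  by split; exact: Vbar_diff_dir.
rewrite /ip -RintegralZl//; last exact: integrable_qip.
rewrite -RintegralD//; last 2 first.
- rewrite (_ : EFin \o _ = fun z : obs R dy dx => c%:E * (EFin \o qip v u) z)%E; last first.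
    by apply/funext => z /=; rewrite EFinM.
  by apply: integrableZl => //; exact: integrable_qip.
- exact: integrable_qip.
apply: ae_eq_Rintegral.
- exact: (measurable_qip (Vbar_diff_dir (VbarZD c Vv Vw)) du).
- by apply: measurable_funD; [apply: measurable_funM => //|]; exact: measurable_qip.
- have [_ _ lin] := hV; apply: (ae_imply (lin c v w Vv Vw)) => z ->.
  by rewrite qformDl qformZl.
Qed.

Lemma ip_ge0 v : diff_dir M v -> 0 <= ip M v v.
Proof.
move=> dv; have -> : ip M v v = \int[PZ]_z `|qip v v z|.
  apply: ae_eq_Rintegral.
  - exact: measurable_qip.
  - by apply: measurableT_comp => //; exact: measurable_qip.
  - by apply: (ae_imply Sigma_posdef_ae) => z pd; rewrite ger0_norm// qform_inv_ge0.
exact: Rintegral_ge0.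
Qed.

Lemma wnorm_sqr v : diff_dir M v -> wnorm M v ^+ 2 = ip M v v.
Proof. by move=> dv; rewrite sqr_sqrtr// ip_ge0. Qed.

(** Both integrands are quadratic forms in [w = mdot *m invmx Sigma], with
    matrices [Sigma] and [Sigma0] whose eigenvalues lie in a common compact
    interval of positive reals. The lemma turns remainders normalized by the
    norm of the representer into remainders normalized by its standard
    deviation. *)
Lemma wnorm_le_sdnorm : exists2 C, 0 <= C &
  forall v, diff_dir M v -> wnorm M v <= C * sdnorm M v.
Proof.
have [c1 [c2 [c10 c20 ev]]] := Sigma_bounds.
exists (Num.sqrt (c2 / c1)) => [|v dv]; first exact: sqrtr_ge0.
rewrite /wnorm /sdnorm -sqrtrM ?divr_ge0 ?(ltW c10) ?(ltW c20)//.
apply: ler_wsqrtr.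
have bnd : {ae PZ, forall z, [/\ 0 <= qsd v z,
    qsd v z <= c2 / c1 * (c1^-1 * sq v z), 0 <= qip v v z &
    qip v v z <= c2 / c1 * qsd v z]}.
  have ss : {ae PZ, forall z, sym_posdef (Sigma M z.2) /\ (Sigma0 M z.2)^T = Sigma0 M z.2}.
    by apply: (ae_imply2 Sigma_posdef_ae Sigma0_sym_ae) => z.
  apply: (ae_imply2 ss ev) => z [pd s0] [{}ev ev0].
  set S := Sigma M z.2; set u := md v z; set w := u *m invmx S.
  have e1 : qsd v z = qform (Sigma0 M z.2) w w.
    by rewrite /w /qform trmx_mul (invmx_sym pd) !mulmxA.
  have e2 : qip v v z = qform S w w by exact: (qform_invE pd).
  have h1 : c1 * qform 1%:M w w <= qform (Sigma0 M z.2) w w.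
    by apply: eigenvalue_ge_qform => // l /ev0 /andP[].
  have h2 : qform (Sigma0 M z.2) w w <= c2 * qform 1%:M w w.
    by apply: eigenvalue_le_qform => // l /ev0 /andP[].
  have h3 : c1 * qform 1%:M w w <= qform S w w.
    by apply: (eigenvalue_ge_qform pd.1) => // l /ev /andP[].
  have h4 : qform S w w <= c2 * qform 1%:M w w.
    by apply: (eigenvalue_le_qform pd.1) => // l /ev /andP[].
  have h5 : qip v v z <= c1^-1 * sq v z.
    by apply: (qform_inv_le pd) => // l /ev /andP[].
  have w0 := qform1_ge0 w.
  have lew (x : R) : c1 * qform 1%:M w w <= x -> c2 * qform 1%:M w w <= c2 / c1 * x.
    by move=> h; rewrite -mulrA ler_pM2l// ler_pdivlMl.
  rewrite e1; rewrite e2 in h5 *; split.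
  - by apply: le_trans h1; rewrite mulr_ge0// ltW.
  - by apply: le_trans h2 _; apply: lew; exact: le_trans h5.
  - by apply: le_trans h3; rewrite mulr_ge0// ltW.
  - by apply: le_trans h4 _; exact: lew.
have isd : PZ.-integrable setT (EFin \o qsd v).
  apply: (@ae_dominated_integrable _ _ _ _ _ (fun z => c2 / c1 * (c1^-1 * sq v z))).
  - exact: measurable_qsd.
  - rewrite (_ : EFin \o _ = fun z : obs R dy dx =>
        (c2 / c1 * c1^-1)%:E * (EFin \o sq v) z)%E; last first.
      by apply/funext => z /=; rewrite !EFinM !muleA.
    by apply: integrableZl => //; exact: integrable_sq.
  - by apply: (ae_imply bnd) => z [h ? _ _]; rewrite ger0_norm.
rewrite -RintegralZl//; apply: ae_le_Rintegral.
- exact: measurable_qip.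
- rewrite (_ : EFin \o _ = fun z : obs R dy dx =>
      (c2 / c1)%:E * (EFin \o qsd v) z)%E; last first.
    by apply/funext => z /=; rewrite EFinM.
  exact: integrableZl.
- by apply: (ae_imply bnd) => z [_ _ -> ->].
Qed.

Lemma wnorm_zero : wnorm M 0 = 0.
Proof.
rewrite /wnorm /ip; under eq_Rintegral => z _.
  rewrite (_ : md 0 z = 0); last exact: (derive_zero_dir _ _).2.
  rewrite /qform mul0mx mul0mx mxE; over.
by rewrite Rintegral_cst// mul0r sqrtr0.
Qed.

Lemma wnorm_ge0 v : 0 <= wnorm M v.
Proof. exact: sqrtr_ge0. Qed.

Lemma sdnorm_ge0 v : 0 <= sdnorm M v.
Proof. exact: sqrtr_ge0. Qed.

Lemma sdnorm_zero : sdnorm M 0 = 0.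
Proof.
rewrite /sdnorm; under eq_Rintegral => z _.
  rewrite (_ : md 0 z = 0); last exact: (derive_zero_dir _ _).2.
  rewrite /qform mul0mx mul0mx mxE; over.
by rewrite Rintegral_cst// mul0r sqrtr0.
Qed.

(** The approximating element is the vector itself; the difference is the zero
    direction, where the derivative exists and vanishes. *)
Lemma V_sub_Vbar : V M D `<=` Vbar M D.
Proof.
move=> v Vv e e0; exists v; split => //; rewrite subrr ?wnorm_zero//.
split.
  by apply: aeW => z; exact: (derive_zero_dir _ _).1.
move=> j; rewrite (_ : (fun z => _) = cst 0); last first.
  by apply/funext => z; rewrite (_ : mdot _ _ _ _ = 0) ?mxE//; exact: (derive_zero_dir _ _).2.
exact: Lfun_cst.
Qed.

(* Only the bilinear calculus of ip is used from here on. *)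
Opaque ip wnorm sdnorm.

Lemma wnormB_sqr_le v w : Vbar M D v -> Vbar M D w ->
  wnorm M (v - w) ^+ 2 <= 2 * (wnorm M v ^+ 2 + wnorm M w ^+ 2).
Proof.
move=> Vv Vw; have dd := Vbar_diff_dir.
apply: (semi_ip_parallelogram VbarZD _ ipZDl _ _ Vv Vw).
- by move=> ? ? /dd ? /dd ?; exact: ipC.
- by move=> ? /dd ?; exact: ip_ge0.
- by move=> ? /dd ?; exact: wnorm_sqr.
Qed.

End weighted_inner_product.

(** * Identification and consistency *)

Lemma cvg0_scale_sqr (R : realType) (K : R) (u : nat -> R) :
  u @ \oo --> (0 : R) -> (K * u n ^+ 2) @[n --> \oo] --> (0 : R).
Proof.
move=> u0; rewrite -[X in _ --> X](_ : K * (0 * 0) = 0); last by rewrite !mulr0.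
by apply: cvgM; [exact: cvg_cst|exact: cvgM].
Qed.

Section parameter_norms.
Context (R : realType) (dth : nat) (H : completeNormedModType R).
Local Notation E := ('rV[R]_dth * H)%type.

Lemma enorm_ge0 n (u : 'rV[R]_n) : 0 <= enorm u.
Proof. exact: sqrtr_ge0. Qed.

Lemma snorm_ge0 (a : E) : 0 <= snorm a.
Proof. by rewrite addr_ge0// enorm_ge0. Qed.

Lemma coord_le_norm n (u : 'rV[R]_n) j : `|u 0 j| <= `|u|.
Proof.
rewrite [leRHS]/Num.norm/= mx_normrE; apply/bigmax_geP; right => /=.
by exists (0, j).
Qed.

Lemma enorm_le_norm n (u : 'rV[R]_n) : enorm u <= Num.sqrt n%:R * `|u|.
Proof.
rewrite -[X in _ * X](@ger0_norm R) ?normr_ge0// -sqrtr_sqr -sqrtrM ?ler0n//.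
rewrite ler_wsqrtr//; apply: (@le_trans _ _ (\sum_(j < n) `|u| ^+ 2)).
  apply: ler_sum => j _; rewrite -[leLHS](@real_normK R) ?num_real//.
  by rewrite ler_sqr ?nnegrE//; exact: coord_le_norm.
by rewrite sumr_const card_ord mulr_natl.
Qed.

Lemma norm_le_enorm n (u : 'rV[R]_n) : `|u| <= enorm u.
Proof.
rewrite [leLHS]/Num.norm/= mx_normrE; apply/bigmax_leP; split; first exact: enorm_ge0.
move=> [i j] _ /=; rewrite (ord1 i) -sqrtr_sqr ler_wsqrtr//.
by rewrite (bigD1 j)//= lerDl; apply: sumr_ge0 => k _; exact: sqr_ge0.
Qed.

Lemma norm_le_snorm (a : E) : `|a| <= snorm a.
Proof.
rewrite prod_normE ge_max /snorm; apply/andP; split.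
  by apply: le_trans (norm_le_enorm _) _; rewrite lerDl.
by rewrite lerDr enorm_ge0.
Qed.

Lemma snorm_le_norm : exists2 C : R, 0 < C & forall a : E, snorm a <= C * `|a|.
Proof.
exists (Num.sqrt dth%:R + 1) => [|a]; first by rewrite ltr_wpDl ?sqrtr_ge0.
rewrite mulrDl mul1r prod_normE lerD//; last by rewrite le_max lexx orbT.
apply: le_trans (enorm_le_norm _) _.
by rewrite ler_wpM2l ?sqrtr_ge0// le_max lexx.
Qed.

Lemma snorm_eq0 (a : E) : snorm a = 0 -> a = 0.
Proof.
move=> a0; apply/eqP; rewrite -normr_eq0 eq_le normr_ge0 andbT.
by rewrite -a0 norm_le_snorm.
Qed.

Lemma near_snorm_lt (a : E) r : 0 < r -> \forall x \near a, snorm (x - a) < r.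
Proof.
move=> r0; have [C C0 hC] := snorm_le_norm.
have rC : 0 < r / C by rewrite divr_gt0.
have := nbhsx_ballx a _ rC; rewrite -ball_normE.
apply: filterS => x h; apply: le_lt_trans (hC _) _.
by rewrite mulrC -(ltr_pdivlMr _ _ C0) distrC.
Qed.

End parameter_norms.

Section consistency.
Context (R : realType) (dy dx drho dth : nat) (H : completeNormedModType R).
Context (M : population dy dx drho dth H) (D : design dth H).
Context (d : measure_display) (Om : measurableType d) (P : probability Om R).
Context (S : sample dy dx drho dth H Om).
Hypotheses (hM : model_ok M) (hD : design_ok M D).
Hypotheses (hahat : psmd M D P S) (hM0 : M0_large M D P S).
Hypotheses (hID : cond_ID M D) (hPEN : cond_PEN M D).
Hypotheses (hCRIT : cond_CRIT M D P S) (hLOC : cond_LOC M D P S).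

Local Notation PZ := (PZ M).
Local Notation alpha0 := (alpha0 M).
Local Notation qf a := (fun z : obs R dy dx =>
  qform (invmx (Sigma M z.2)) (mu_ M z.2 a) (mu_ M z.2 a)).

Lemma measurable_Qint a : A M a -> measurable_fun setT (qf a).
Proof.
have [[ce _ _ _ _] _] := hM => Aa; apply: measurable_qform.
- exact: (measurable_invmx (measurable_Sigma hM)).
- by move=> j; have [_ m _] := ce a Aa j; exact: (measurable_fun_X m).
- by move=> j; have [_ m _] := ce a Aa j; exact: (measurable_fun_X m).
Qed.

Lemma Q_absE a : A M a -> Q M a = (\int[PZ]_z `|(qf a z)%:E|)%E.
Proof.
move=> Aa; have m := measurable_Qint Aa; apply: ae_eq_integral => //.
- exact/measurable_EFinP.
- by apply: measurableT_comp => //; exact/measurable_EFinP.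
- apply: (ae_imply (Sigma_posdef_ae hM)) => z pd _.
  by rewrite gee0_abs// lee_fin qform_inv_ge0.
Qed.

Lemma Q_ge0 a : A M a -> (0 <= Q M a)%E.
Proof. by move=> Aa; rewrite Q_absE//; exact: integral_ge0. Qed.

(** A null criterion forces a null conditional moment, as the weights are
    positive definite on the support of X, which carries all the mass; then
    identification applies. *)
Lemma Q_gt0 a : A M a -> a != alpha0 -> (0 < Q M a)%E.
Proof.
move=> Aa aN; rewrite lt_neqAle Q_ge0// andbT eq_sym; apply/eqP => Q0.
move: (Q0); rewrite Q_absE// => /ae_eq_integral_abs -/(_ measurableT).
move=> /(_ (measurableT_comp (@EFin_measurable _ _) (measurable_Qint Aa))) h.
have [id _ _ _] := hID.
have /(iffLR (id a Aa)) : {ae PZ, forall z, mu_ M z.2 a = 0}.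
  apply: (ae_imply2 (Sigma_posdef_ae hM) h) => z pd /(_ I) [].
  exact: qform_inv_eq0.
by move/snorm_eq0/eqP; rewrite subr_eq0 (negbTE aN).
Qed.

(** On the compact set [Theta `*` {Pen <= b}] the lower semicontinuous function
    [Q] is bounded away from [0] off any neighbourhood of [alpha0]. Compactness
    is used as near-covering, along the levels [y = 1 / n.+1]. *)
Lemma Q_identification (b r : R) : 0 < r -> exists2 y : R, 0 < y &
  forall a, A M a -> (Pen M a.2 <= b%:E)%E -> (Q M a <= y%:E)%E ->
    snorm (a - alpha0) < r.
Proof.
move=> r0; have [_ [cT _ _ _ _] lsc _] := hID; have [_ _ cP] := hPEN.
have := compact_setX cT (cP b).
move=> /(iffLR (compact_near_coveringP _)).
move=> /(_ nat \oo (fun n a => A M a -> (Q M a <= (n.+1%:R^-1)%:E)%E ->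
  snorm (a - alpha0) < r) _) [].
  move=> x [/= Ax _]; have [->|xN] := eqVneq x alpha0.
    exists ([set x' | snorm (x' - alpha0) < r], setT).
      by split; [exact: near_snorm_lt|exact: filterT].
    by move=> [x' n] [].
  have [y y0 yQ] : exists2 y : R, 0 < y & (y%:E < Q M x)%E.
    have := Q_gt0 Ax xN; case: (Q M x) => [q||//].
    - by rewrite lte_fin => q0; exists (q / 2); rewrite ?lte_fin; lra.
    - by exists 1; rewrite ?ltry.
  have [s s0 sQ] := lsc x Ax y yQ.
  exists ([set x' | snorm (x' - x) < s], [set n | n.+1%:R^-1 < y]).
    by split; [exact: near_snorm_lt|exact: near_infty_natSinv_lt (PosNum y0)].
  move=> [x' n] [/= xs ny] Ax' Qx'; exfalso.
  have := lt_le_trans (sQ _ Ax' xs) Qx'; rewrite lte_fin ltNge => /negP; apply.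
  exact: ltW.
move=> n _ /(_ n (leqnn n)) /= h; exists n.+1%:R^-1 => // a Aa Pa Qa.
by apply: h => //; split.
Unshelve. all: by end_near. Qed.

Lemma lam_gt0 n : 0 < lam D n.
Proof. by have [[h _ _] _ _] := hPEN. Qed.

Lemma eta_gt0 n : 0 < eta D n.
Proof. by have [_ [h _] _ _] := hD. Qed.

Lemma delta_gt0 n : 0 < delta D n.
Proof. by have [_ _ _ [/(_ n)/andP[h _] _ _ _]] := hD. Qed.

Lemma rates_le n : [/\ lam D n <= delta D n ^+ 2, eta D n <= delta D n ^+ 2 &
  (Q M (Pia0 M D n) <= (delta D n ^+ 2)%:E)%E].
Proof.
have [_ _ [_ /(_ n) e] _] := hLOC.
have : (maxe (delta D n ^+ 2)%:E (maxe (Q M (Pia0 M D n))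
   (maxe (lam D n)%:E (eta D n)%:E)) <= (delta D n ^+ 2)%:E)%E by rewrite e.
by rewrite !ge_max !lee_fin => /and4P[_ h1 h2 h3].
Qed.

Lemma Pen_ge0 h : (0 <= Pen M h)%E.
Proof. by have [_] := hM; exact. Qed.

Lemma lam_Pen_ge0 n h : (0 <= (lam D n)%:E * Pen M h)%E.
Proof. by rewrite mule_ge0 ?Pen_ge0// lee_fin ltW// lam_gt0. Qed.

Lemma pen_leE n a : pen_le M D n a = (Pen M a.2 <= (M0 D)%:E)%E :> Prop.
Proof. by rewrite /pen_le EFinM lee_pmul2l// lte_fin lam_gt0. Qed.

Lemma pen_ltE n a : pen_lt M D n a = (Pen M a.2 < (M0 D)%:E)%E :> Prop.
Proof. by rewrite /pen_lt EFinM lte_pmul2l// lte_fin lam_gt0. Qed.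

Lemma M0_gt0 : 0 < M0 D.
Proof.
have [_ _ /(_ 0) + _] := hM0; rewrite pen_ltE => h.
by rewrite -lte_fin; apply: le_lt_trans h; exact: Pen_ge0.
Qed.

(** Comparison of the approximate minimizer with [Pia0]: the criterion there,
    the penalty and the optimization error are all of order [delta ^+ 2]. *)
Lemma Qhat_ahat_bounded : bounded_in_prob P (fun K n => [set w |
  Qhat M S n w (ahat S n w) <= K * delta D n ^+ 2]).
Proof.
have [_ _ opt] := hahat; have [[c0 c00 cr] _] := hCRIT.
apply: bounded_in_probI opt cr _ => K L.
exists (`|K| + `|L| + M0 D + c0); apply: nearW => n w [/= op cr].
have [lle ele Qle] := rates_le n.
have AkP : Ak M D n (Pia0 M D n) by have [/(_ n) []] := hM0.
have penP : pen_le M D n (Pia0 M D n) by have [/(_ n) []] := hM0.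
have h1 : ((Qhat M S n w (ahat S n w))%:E <= crit M D S n w (ahat S n w))%E.
  by rewrite /crit leeDl// lam_Pen_ge0.
have h2 : (crit M D S n w (ahat S n w) <=
    crit M D S n w (Pia0 M D n) + (K * eta D n)%:E)%E.
  by apply: le_trans op _; rewrite leeD2r//; apply: ereal_inf_lbound; exists (Pia0 M D n).
have h3 : (crit M D S n w (Pia0 M D n) <=
    (c0 * delta D n ^+ 2 + L * eta D n + lam D n * M0 D)%:E)%E.
  rewrite /crit EFinD leeD//; apply: le_trans cr _; rewrite EFinD leeD2r//.
  by rewrite EFinM lee_pmul2l// lte_fin.
have := le_trans h1 (le_trans h2 (leeD2r _ h3)); rewrite -EFinD lee_fin.
move=> /le_trans; apply.
have e0 := eta_gt0 n.
have hK : K * eta D n <= `|K| * delta D n ^+ 2.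
  apply: (@le_trans _ _ (`|K| * eta D n)); first by rewrite ler_wpM2r ?ler_norm// ltW.
  by rewrite ler_wpM2l.
have hL : L * eta D n <= `|L| * delta D n ^+ 2.
  apply: (@le_trans _ _ (`|L| * eta D n)); first by rewrite ler_wpM2r ?ler_norm// ltW.
  by rewrite ler_wpM2l.
have hl : lam D n * M0 D <= M0 D * delta D n ^+ 2.
  by rewrite mulrC ler_wpM2l// ltW// M0_gt0.
rewrite !mulrDl; lra.
Qed.

(** A small sample criterion at the estimator makes the population criterion
    small there, hence [Q_identification] localizes the estimator. *)
Lemma consistency (r : R) : 0 < r ->
  wpa1 P (fun n => [set w | snorm (ahat S n w - alpha0) < r]).
Proof.
move=> r0; have [y y0 hy] := Q_identification (M0 D) r0.
have [_ [c c0 low]] := hCRIT.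
have [_ inM0 _ _] := hM0.
apply: (wpa1_bounded Qhat_ahat_bounded) => K.
apply: (wpa1_bounded low) => L.
apply: wpa1_sub inM0.
have [_ _ [dbar0 _ cdbar] [dl cdelta _ _]] := hD.
have cv : (K * delta D n ^+ 2 + L * dbar D n ^+ 2) @[n --> \oo] --> (0 : R).
  by rewrite -[X in _ --> X]addr0; apply: cvgD; exact: cvg0_scale_sqr.
near=> n => w /= AkM lo up.
have [[Aa _] pl] := AkM.
apply: hy => //; first by rewrite -(pen_leE n).
have := lo _ AkM; rewrite -lee_pdivlMl// => /le_trans; apply; rewrite -EFinM lee_fin.
rewrite ler_pdivrMl//; apply: (@le_trans _ _ (K * delta D n ^+ 2 + L * dbar D n ^+ 2)).
  by rewrite lerD2r.
apply/ltW; near: n; apply: (cvgr_lt _ cv); exact: mulr_gt0.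
Unshelve. all: by end_near. Qed.

End consistency.

(** * Rates of convergence *)

Opaque Q Qhat phidot Zn.

Section local_sieve.
Context (R : realType) (dy dx drho dth : nat) (H : completeNormedModType R).
Context (M : population dy dx drho dth H) (D : design dth H).
Context (d : measure_display) (Om : measurableType d) (P : probability Om R).
Context (S : sample dy dx drho dth H Om).
Hypotheses (hM : model_ok M) (hD : design_ok M D) (hAos : Aos_ok M D).
Hypotheses (hV : tangent_ok M D) (hphi : riesz_ok M D).
Hypotheses (hahat : psmd M D P S) (hM0 : M0_large M D P S).
Hypotheses (hID : cond_ID M D) (hPEN : cond_PEN M D).
Hypotheses (hCRIT : cond_CRIT M D P S) (hLOC : cond_LOC M D P S).
Hypothesis (hPHI : cond_PHI M D).

Local Notation alpha0 := (alpha0 M).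
Local Notation Pia0 := (Pia0 M D).

Lemma snorm_subPi n a :
  snorm (a - alpha0) <= snorm (a - Pia0 n) + `|alpha0.2 - Pih0 D n|.
Proof.
rewrite /snorm /= -addrA lerD2l -[a.2 - alpha0.2](subrKA (Pih0 D n)).
by rewrite [X in _ <= _ + X]distrC ler_normD.
Qed.

Lemma snorm_Pia0 n : snorm (Pia0 n - alpha0) = `|Pih0 D n - alpha0.2|.
Proof.
rewrite /snorm /= subrr (_ : enorm 0 = 0) ?add0r//.
by rewrite /enorm big1 ?sqrtr0// => j _; rewrite mxE expr0n.
Qed.

Lemma near_Pia0_Aosn : \forall n \near \oo, Aosn M D n (Pia0 n).
Proof.
have [_ _ [r r0 hr]] := hAos; have [_ [_ _ _ _ [_ cP]] _ _] := hID.
have [inM0 _ plt _] := hM0.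
near=> n; split; last by have [] := inM0 n.
apply: (hr n) => //; first by have [[]] := inM0 n.
by rewrite snorm_Pia0; near: n; exact: (cvgr_lt _ cP).
Unshelve. all: by end_near. Qed.

Lemma Aos_V a : Aos D a -> V M D (a - alpha0).
Proof. by move=> Aa; apply: sub_span; exists a. Qed.

Lemma Aos_Vbar a : Aos D a -> Vbar M D (a - alpha0).
Proof. by move=> /Aos_V; exact: V_sub_Vbar. Qed.

Lemma Aosn_Vk n a : Aosn M D n a -> Vk M D n (a - alpha0n D n).
Proof. by move=> Aa; apply: sub_span; exists a. Qed.

Lemma Aosn_subPi_Vk n a : Aosn M D n a -> Aosn M D n (Pia0 n) ->
  Vk M D n (a - Pia0 n).
Proof.
move=> Aa AP; rewrite -(subrKA (alpha0n D n)) -[X in _ + X]opprB.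
by apply: spanB; exact: Aosn_Vk.
Qed.

Lemma Vk_wnorm0 n v : Vk M D n v -> wnorm M v = 0 -> v = 0.
Proof. by have [[_ _ /(_ n)[_ h] _ _] _ _] := hPHI; exact: h. Qed.

(** [delta_s] vanishes only if [tau] does, that is, if no point of the local
    sieve is separated from [Pia0]. As [wnorm] is a norm on [Vk], the local sieve
    is then a singleton and [Vk] has dimension at most [1], whereas its dimension
    diverges. The lemma matters because [Mn] is the minimum of two terms, one of
    which is [ln 1 = 0] when [delta_s = 0]. *)
Lemma near_delta_s_gt0 : \forall n \near \oo, 0 < delta_s M D n.
Proof.
have [[ckn _] _ _ [_ _ ub _]] := hD.
have [_ _ _ [dim [hdim [c1 [c2 [/andP[c10 _] hc]]]]] _] := hphi.
near=> n.
have AP : Aosn M D n (Pia0 n) by near: n; exact: near_Pia0_Aosn.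
have dim2 : (1 < dim n)%N.
  rewrite -(ltr_nat R) (lt_le_trans _ (proj1 (andP (hc n))))//.
  rewrite mulrC -ltr_pdivrMr// mul1r.
  apply: (@lt_le_trans _ _ (Num.truncn c1^-1).+1%:R); first exact: truncnS_gt.
  by rewrite ler_nat; near: n; move/cvgnyPge : ckn; exact.
have [a [Aa wa]] : exists a, Aosn M D n a /\ wnorm M (a - Pia0 n) != 0.
  apply: contrapT => /forallNP h.
  have single a : Aosn M D n a -> a = Pia0 n.
    move=> Aa; apply/eqP; rewrite -subr_eq0; apply/eqP.
    apply: (@Vk_wnorm0 n); first exact: Aosn_subPi_Vk.
    by apply/eqP/negPn/negP => w0; apply: (h a).
  have [hd _] := hdim n; move: dim2; rewrite ltnNge => /negP; apply.
  apply: (@has_dim_span1_le1 _ _ (Pia0 n - alpha0n D n)).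
  rewrite (_ : [set _] = [set a - alpha0n D n | a in Aosn M D n])//.
  by apply/seteqP; split => [x ->|x [a /single -> <-]//]; exists (Pia0 n).
have wa0 : 0 < wnorm M (a - Pia0 n) by rewrite lt_neqAle eq_sym wa wnorm_ge0.
have sa0 : 0 < snorm (a - Pia0 n).
  rewrite lt_neqAle eq_sym snorm_ge0 andbT; apply/eqP => /snorm_eq0 e.
  by move: wa; rewrite e wnorm_zero eqxx.
have tau0 : 0 < tau M D n.
  apply: (@lt_le_trans _ _ (snorm (a - Pia0 n) / wnorm M (a - Pia0 n))).
    exact: divr_gt0.
  by apply: ub_le_sup => //; exists a.
apply: ltr_wpDl; first exact: normr_ge0.
exact: (mulr_gt0 tau0 (delta_gt0 hD n)).
Unshelve. all: by end_near. Qed.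

Lemma near_Mn_ge (K : R) : \forall n \near \oo, K <= Mn M D n.
Proof.
have [_ _ _ [_ _ _ cds]] := hD.
near=> n; rewrite /Mn le_min; apply/andP; split.
  have : expR (expR K) <= n.+1%:R :> R.
    apply: (@le_trans _ _ (Num.truncn (expR (expR K))).+1%:R).
      by apply/ltW; exact: truncnS_gt.
    rewrite ler_nat ltnS; near: n; exact: nbhs_infty_ge.
  move=> h; have h1 : expR K <= ln n.+1%:R.
    by rewrite -[leLHS]expRK ler_ln ?posrE ?expR_gt0.
  rewrite -[leLHS]expRK ler_ln ?posrE ?expR_gt0//.
  exact: lt_le_trans (expR_gt0 _) h1.
have ds0 : 0 < delta_s M D n by near: n; exact: near_delta_s_gt0.
have dsK : delta_s M D n < (expR K)^-1.
  by near: n; apply: (cvgr_lt _ cds); rewrite invr_gt0 expR_gt0.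
rewrite -ler_expR lnK; last by rewrite posrE addr_gt0// invr_gt0.
apply: (@le_trans _ _ (delta_s M D n)^-1); last by rewrite lerDl.
by rewrite -[leLHS]invrK lef_pV2 ?posrE ?invr_gt0 ?expR_gt0// ltW.
Unshelve. all: by end_near. Qed.

End local_sieve.

Lemma sqr_le_linear (R : realType) (x b y : R) :
  0 <= b -> 0 <= y -> 0 <= x -> x ^+ 2 <= b * y ^+ 2 -> x <= (b + 1) * y.
Proof.
move=> b0 y0 x0 h; rewrite -ler_sqr ?nnegrE//; last by rewrite mulr_ge0// addr_ge0.
apply: le_trans h _; rewrite exprMn ler_wpM2r ?sqr_ge0//; nra.
Qed.

Lemma le_two_mul (R : realType) (x y z k c e : R) :
  x <= 2 * (y + z) -> y <= k * e -> z <= c * e -> x <= 2 * (k + c) * e.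
Proof. lra. Qed.

Section rates_ahat.
Context (R : realType) (dy dx drho dth : nat) (H : completeNormedModType R).
Context (M : population dy dx drho dth H) (D : design dth H).
Context (d : measure_display) (Om : measurableType d) (P : probability Om R).
Context (S : sample dy dx drho dth H Om).
Hypotheses (hM : model_ok M) (hD : design_ok M D) (hAos : Aos_ok M D).
Hypotheses (hV : tangent_ok M D) (hphi : riesz_ok M D).
Hypotheses (hahat : psmd M D P S) (hM0 : M0_large M D P S).
Hypotheses (hID : cond_ID M D) (hPEN : cond_PEN M D).
Hypotheses (hCRIT : cond_CRIT M D P S) (hLOC : cond_LOC M D P S).
Hypothesis (hPHI : cond_PHI M D).

Local Notation alpha0 := (alpha0 M).
Local Notation Pia0 := (Pia0 M D).

Lemma Tn_ge0 n : 0 <= 4%:R * Mn M D n ^+ 2 * delta D n.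
Proof.
by apply: mulr_ge0; [rewrite mulr_ge0 ?sqr_ge0|exact: (ltW (delta_gt0 hD n))].
Qed.

(** The penalty bound at the estimator is the step [t = 0] of the bound along
    the perturbations by [ustar]. *)
Lemma ahat_Aosn : wpa1 P (fun n => [set w | Aosn M D n (ahat S n w)]).
Proof.
have [_ _ [r r0 hr]] := hAos; have [inA _ _] := hahat.
have [_ _ _ plt] := hM0.
have cons := consistency hM hD hahat hM0 hID hPEN hCRIT hLOC r0.
apply: wpa1_sub (wpa1I cons plt); apply: nearW => n w [/= c /(_ 0)].
rewrite scale0r addr0 /Tn /= normr0 => /(_ (Tn_ge0 n)) pl.
by split; [apply: (hr n) => //; case: (inA n w)|exact: inA].
Qed.

(** On the local sieve [Q] is equivalent to [wnorm ^+ 2] and is bounded by the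
    sample criterion, which is [O_P(delta ^+ 2)] at the estimator. *)
Lemma wnorm_ahat_bounded : bounded_in_prob P (fun K n => [set w |
  Aosn M D n (ahat S n w) /\ wnorm M (ahat S n w - alpha0) <= K * delta D n]).
Proof.
have [_ [c1 [c2 [/andP[c10 _] Qw]]] [[c c0 low] _] _] := hLOC.
have up := Qhat_ahat_bounded hM hD hahat hM0 hPEN hCRIT hLOC.
have lowup := bounded_in_probI (C := fun K n => [set w | Aosn M D n (ahat S n w) ->
  wnorm M (ahat S n w - alpha0) <= K * delta D n]) low up.
apply: bounded_in_probI (lowup _) (wpa1_bounded_in_prob ahat_Aosn) _; last first.
  by move=> K _; exists K; apply: nearW => n w [/= h An]; split => //; exact: h.
move=> L K; pose b := (`|K| + `|L|) / (c1 * c); exists (b + 1).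
have b0 : 0 <= b by rewrite divr_ge0 ?addr_ge0// mulr_ge0// ltW.
apply: nearW => n w [/= lo u] Aa.
have d0 := delta_gt0 hD n.
apply: sqr_le_linear => //; [exact: ltW|exact: wnorm_ge0|].
have /andP[q _] := Qw _ Aa.1; have := lo _ Aa.
have cq : (c%:E * (c1 * wnorm M (ahat S n w - alpha0) ^+ 2)%:E <=
    c%:E * Q M (ahat S n w))%E by rewrite lee_pmul2l// lte_fin.
move=> /(le_trans cq); rewrite -EFinM lee_fin => h.
rewrite mulrAC ler_pdivlMr ?mulr_gt0// mulrC [c1 * c]mulrC -mulrA.
apply: le_trans h _; rewrite mulrDl; apply: lerD; last first.
  by rewrite ler_wpM2r ?sqr_ge0// ler_norm.
by apply: le_trans u _; rewrite ler_wpM2r ?sqr_ge0// ler_norm.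
Qed.

Lemma wnorm_Pia0 : exists2 C : R, 0 <= C &
   forall n, Aosn M D n (Pia0 n) -> wnorm M (Pia0 n - alpha0) ^+ 2 <= C * delta D n ^+ 2.
Proof.
have [_ [c1 [c2 [/andP[c10 _] Qw]]] _ _] := hLOC.
exists c1^-1 => [|n AP]; first by rewrite invr_ge0 ltW.
have /andP[q _] := Qw _ AP.1; rewrite ler_pdivlMl//.
have [_ _ Qle] := rates_le hLOC n.
by rewrite -lee_fin; exact: le_trans q Qle.
Qed.

Lemma tau_ge0 n : 0 <= tau M D n.
Proof.
have [_ _ _ [_ _ ub _]] := hD.
have [[r rr]|h] := pselect (exists r, ratios M D n r).
  apply: (@le_trans _ _ r); last exact: ub_le_sup.
  by case: rr => a [_ _ ->]; rewrite divr_ge0 ?snorm_ge0// wnorm_ge0.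
rewrite /tau (_ : ratios M D n = set0) ?sup0//.
by apply/seteqP; split => // r rr; apply: h; exists r.
Qed.

(** The definition of [tau], extended to the points at [wnorm]-distance [0] of
    [Pia0], which coincide with it. *)
Lemma snorm_le_tau n a : Aosn M D n a -> Aosn M D n (Pia0 n) ->
  snorm (a - Pia0 n) <= tau M D n * wnorm M (a - Pia0 n).
Proof.
move=> Aa AP; have [_ _ _ [_ _ ub _]] := hD.
have Vd := Aosn_subPi_Vk Aa AP.
have [w0|w0] := eqVneq (wnorm M (a - Pia0 n)) 0.
  rewrite (Vk_wnorm0 hPHI Vd w0) wnorm_zero mulr0.
  by rewrite /snorm/= normr0 addr0 /enorm big1 ?sqrtr0// => j _; rewrite mxE expr0n.
have wp : 0 < wnorm M (a - Pia0 n) by rewrite lt_neqAle eq_sym w0 wnorm_ge0.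
by rewrite -ler_pdivrMr//; apply: ub_le_sup => //; exists a.
Qed.

(** The strong norm is reached through [Pia0]: [tau] converts the weak rate
    into a strong one inside the sieve, and the approximation error of the sieve
    is the other term of [delta_s]. *)
Lemma ahat_rates : bounded_in_prob P (fun K n => [set w |
  [/\ Aosn M D n (ahat S n w), wnorm M (ahat S n w - alpha0) <= K * delta D n &
      snorm (ahat S n w - alpha0) <= K * delta_s M D n]]).
Proof.
have AP := near_Pia0_Aosn hAos hM0 hID.
have [C C0 wP] := wnorm_Pia0.
apply: bounded_in_probI wnorm_ahat_bounded (wpa1_bounded_in_prob ahat_Aosn) _ => K _.
pose b := 2 * (`|K| ^+ 2 + C).
have b0 : 0 <= b by rewrite mulr_ge0// addr_ge0// sqr_ge0.
exists (`|K| + b + 1); near=> n => w [/= [Aa wa] _].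
have APn : Aosn M D n (Pia0 n) by near: n.
have d0 := delta_gt0 hD n; have t0 := tau_ge0 n.
have ds0 : 0 <= delta_s M D n by rewrite addr_ge0// mulr_ge0// ltW.
have wK : wnorm M (ahat S n w - alpha0) <= `|K| * delta D n.
  by apply: le_trans wa _; rewrite ler_wpM2r ?ler_norm// ltW.
split => //.
  by apply: le_trans wK _; rewrite ler_wpM2r ?(ltW d0)// -addrA lerDl addr_ge0.
have wd : wnorm M (ahat S n w - Pia0 n) <= (b + 1) * delta D n.
  apply: sqr_le_linear => //; [exact: ltW|exact: wnorm_ge0|].
  have tri := wnormB_sqr_le hM hV hID (Aos_Vbar M Aa.1) (Aos_Vbar M APn.1).
  rewrite opprB addrA subrK in tri.
  apply: (le_two_mul tri _ (wP n APn)).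
  by rewrite -exprMn lerXn2r ?nnegrE ?wnorm_ge0// mulr_ge0// ltW.
have := snorm_subPi M D n (ahat S n w) => /le_trans; apply.
apply: (@le_trans _ _ ((b + 1) * delta_s M D n)); last first.
  by rewrite ler_wpM2r// -addrA lerDr.
rewrite /delta_s mulrDr addrC lerD//.
  by rewrite -[leLHS]mul1r ler_wpM2r// lerDr.
apply: (le_trans (snorm_le_tau Aa APn)).
by rewrite mulrCA ler_wpM2l.
Unshelve. all: by end_near. Qed.

(** Since [Mn] diverges, it eventually exceeds the random constants in the rates. *)
Lemma ahat_Nosn : wpa1 P (fun n => [set w |
  Aosn M D n (ahat S n w) /\ Nosn M D n (ahat S n w)]).
Proof.
have [inA _ _] := hahat; have [_ inM0 _ _] := hM0.
apply: (wpa1_bounded ahat_rates) => K.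
apply: wpa1_sub inM0; near=> n => w /= [Ak pl] [Aa wa sa].
have KM : K <= Mn M D n by near: n; exact: (near_Mn_ge hD hAos hphi hM0 hID hPHI).
have d0 := delta_gt0 hD n.
have ds0 : 0 <= delta_s M D n by apply: addr_ge0 => //; exact: (mulr_ge0 (tau_ge0 n) (ltW d0)).
split => //; split; last exact: inA.
split; first by case: Ak.
- by apply: le_trans wa _; rewrite ler_wpM2r// ltW.
- by apply: le_trans sa _; rewrite ler_wpM2r.
- exact: pl.
Unshelve. all: by end_near. Qed.

End rates_ahat.

(** * Perturbations along the representer *)

Section penalty.
Context (R : realType) (dy dx drho dth : nat) (H : completeNormedModType R).
Context (M : population dy dx drho dth H) (D : design dth H).
Context (d : measure_display) (Om : measurableType d) (P : probability Om R).
Context (S : sample dy dx drho dth H Om).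
Hypotheses (hM : model_ok M) (hD : design_ok M D) (hAos : Aos_ok M D).
Hypotheses (hV : tangent_ok M D) (hphi : riesz_ok M D).
Hypotheses (hahat : psmd M D P S) (hM0 : M0_large M D P S).
Hypotheses (hID : cond_ID M D) (hPEN : cond_PEN M D).
Hypotheses (hCRIT : cond_CRIT M D P S) (hLOC : cond_LOC M D P S).
Hypotheses (hPHI : cond_PHI M D) (hLQA : cond_LQA M D P S).

Local Notation alpha0 := (alpha0 M).

Lemma Aos_Pen a : Aos D a -> exists2 p : R, Pen M a.2 = p%:E & 0 <= p <= M0 D.
Proof.
have [_ /(_ 0) sub _] := hAos => /sub [_ _].
rewrite (pen_ltE hPEN); have := Pen_ge0 hM a.2.
case: (Pen M a.2) => [p||]//; rewrite !lee_fin lte_fin => p0 pM.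
by exists p => //; rewrite p0 ltW.
Qed.

Lemma sup_pen_diff_bounds :
  0 <= sup_pen_diff M D <= M0 D /\
  forall a b, Aos D a -> Aos D b ->
    fine (Pen M a.2) - fine (Pen M b.2) <= sup_pen_diff M D.
Proof.
rewrite /sup_pen_diff; set X := [set r | _].
have ubX : ubound X (M0 D).
  move=> _ [a [b [/Aos_Pen[p -> /andP[p0 pM]] /Aos_Pen[q -> /andP[q0 qM]] ->]]].
  by rewrite ler_norml /=; apply/andP; split; lra.
have X0 r : X r -> 0 <= r by move=> [a [b [_ _ ->]]].
have sX r : X r -> r <= sup X by move=> Xr; apply: ub_le_sup => //; exists (M0 D).
split.
  have [[r Xr]|h] := pselect (exists r, X r).
    by rewrite (le_trans (X0 _ Xr) (sX _ Xr)) ge_sup//; exists r.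
  rewrite (_ : X = set0) ?sup0 ?lexx ?(ltW (M0_gt0 hM hM0 hPEN))//.
  by apply/seteqP; split => // r Xr; apply: h; exists r.
by move=> a b Aa Ab; apply: le_trans (ler_norm _) _; apply: sX; exists a, b.
Qed.

(** The two alternatives on the penalty level give the same conclusion: changing
    the penalty inside [Aos] costs at most [g = o(1/n)], with [g] either the
    oscillation of the penalty or [lam * M0]. *)
Lemma penalty_gap : exists g : nat -> R,
  [/\ forall n, 0 <= g n <= M0 D * lam D n, is_o_inv g &
  forall n a b, Aos D a -> Aos D b ->
    ((lam D n)%:E * Pen M a.2 <= (lam D n)%:E * Pen M b.2 + (g n)%:E)%E].
Proof.
have M00 := M0_gt0 hM hM0 hPEN.
have [_ _ _ [og|og]] := hLOC.
  have [/andP[s0 sM] sP] := sup_pen_diff_bounds.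
  exists (fun n => lam D n * sup_pen_diff M D); split => //.
    move=> n; have l0 := lam_gt0 hPEN n.
    by rewrite mulr_ge0 ?(ltW l0)//= mulrC ler_wpM2r// ltW.
  move=> n a b Aa Ab; have := sP _ _ Aa Ab; have l0 := lam_gt0 hPEN n.
  have [p -> _] := Aos_Pen Aa; have [q -> _] := Aos_Pen Ab.
  rewrite /= -!EFinM -EFinD lee_fin -mulrDr ler_pM2l//; lra.
exists (fun n => lam D n * M0 D); split.
- move=> n; have l0 := lam_gt0 hPEN n.
  by rewrite mulrC lexx andbT mulr_ge0 ?ltW.
- rewrite /is_o_inv; have -> : (fun n => n%:R * (lam D n * M0 D)) =
      (fun n => (n%:R * lam D n) * M0 D) by apply/funext => n; rewrite mulrA.
  by rewrite -[X in _ --> X](mul0r (M0 D)); apply: cvgM => //; exact: cvg_cst.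
- move=> n a b Aa Ab; have l0 := lam_gt0 hPEN n.
  have [p -> /andP[p0 pM]] := Aos_Pen Aa; have [q -> /andP[q0 _]] := Aos_Pen Ab.
  by rewrite -!EFinM -EFinD lee_fin -mulrDr ler_pM2l//; lra.
Qed.

Lemma parameter_bounded : exists2 B : R, 0 < B &
  forall a, A M a -> (Pen M a.2 <= (M0 D)%:E)%E -> `|a| <= B.
Proof.
have [_ [cT _ _ _ _] _ _] := hID; have [_ _ cP] := hPEN.
have [B1 [_ hB1]] := compact_bounded cT.
have [B2 [_ hB2]] := compact_bounded (cP (M0 D)).
exists (`|B1| + `|B2| + 1) => [|a Aa Pa]; first by rewrite ltr_wpDl// addr_ge0.
rewrite prod_normE ge_max; apply/andP; split.
  apply: hB1 => //; have := ler_norm B1; have := normr_ge0 B2; lra.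
apply: hB2 => //; have := ler_norm B2; have := normr_ge0 B1; lra.
Qed.

(** The whole segment [ahat + Tn *: ustar] lies in the bounded set of parameters
    with penalty at most [M0]. Its length exceeds [delta] by the diverging factor
    [4 * Mn ^+ 2], so steps of order [delta] move the estimator by a vanishing
    distance and stay in the neighbourhood [Aos]. *)
Lemma ahat_shift_Aosn (K : R) : wpa1 P (fun n => [set w |
  forall t, `|t| <= K * delta D n ->
   Tn M D n t /\ Aosn M D n (ahat S n w + t *: ustar M D n)]).
Proof.
have [B B0 hB] := parameter_bounded.
have [C C0 hC] := @snorm_le_norm R dth H.
have [_ _ [r r0 hr]] := hAos.
have [lqa _ _ _] := hLQA.
have [_ _ _ plt] := hM0.
have inN := ahat_Nosn hM hD hAos hV hphi hahat hM0 hID hPEN hCRIT hLOC hPHI.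
pose r1 := r / (2 * C); have r10 : 0 < r1 by rewrite divr_gt0 ?mulr_gt0.
have cons := consistency hM hD hahat hM0 hID hPEN hCRIT hLOC r10.
apply: wpa1_sub (wpa1I inN (wpa1I plt cons)).
near=> n => w [/= [_ Nw] [pw cw]] t tK.
have d0 := delta_gt0 hD n.
set a := ahat S n w in Nw pw cw *; set u := ustar M D n in pw *.
have [M1 MK MB] : [/\ 1 <= Mn M D n, `|K| <= Mn M D n &
     2 * B * `|K| / r1 <= Mn M D n].
  by split; near: n; exact: (near_Mn_ge hD hAos hphi hM0 hID hPHI).
pose t0 := 4%:R * Mn M D n ^+ 2 * delta D n.
have Mn2 : Mn M D n <= Mn M D n ^+ 2 by rewrite expr2 ler_peMr// (le_trans ler01).
have Mp : 0 < Mn M D n by apply: lt_le_trans ltr01 M1.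
have t00 : 0 < t0 by apply: mulr_gt0 => //; apply: mulr_gt0 => //; exact: exprn_gt0.
have tK' : `|t| <= `|K| * delta D n.
  by apply: le_trans tK _; rewrite ler_wpM2r ?(ltW d0)// ler_norm.
have Tt : Tn M D n t.
  rewrite /Tn/=; apply: le_trans tK' _; rewrite ler_wpM2r ?(ltW d0)//.
  by apply: (le_trans MK); apply: (le_trans Mn2); rewrite ler_peMl ?sqr_ge0// ler1n.
have Tt0 : Tn M D n t0 by rewrite /Tn/= gtr0_norm.
have T0 : Tn M D n 0 by rewrite /Tn/= normr0 ltW.
have Pw (s : R) : Tn M D n s -> (Pen M (a + s *: u)%R.2 <= (M0 D)%:E)%E.
  by move=> /pw; rewrite (pen_ltE hPEN); exact: ltW.
have bd (s : R) : Tn M D n s -> `|a + s *: u| <= B.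
  move=> Ts; apply: hB; last exact: Pw.
  by have [] := lqa n a s Nw Ts.
have t0u : `|t0 *: u| <= 2 * B.
  have := bd _ Tt0; have := bd _ T0; rewrite scale0r addr0 => h1 h2.
  have -> : t0 *: u = (a + t0 *: u) - a by rewrite addrC addKr.
  by apply: le_trans (ler_normB _ _) _; lra.
have tu : `|t *: u| <= r1.
  have -> : t *: u = (t / t0) *: (t0 *: u) by rewrite scalerA divfK// gt_eqF.
  rewrite normrZ; apply: (@le_trans _ _ (`|K| / Mn M D n * (2 * B))).
    apply: ler_pM => //.
    rewrite normrM normfV (gtr0_norm t00) ler_pdivrMr//.
    apply: le_trans tK' _.
    have -> : `|K| / Mn M D n * t0 = 4 * Mn M D n * (`|K| * delta D n).
      by rewrite /t0; field; rewrite gt_eqF.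
    by rewrite ler_peMl ?mulr_ge0 ?(ltW d0)//; lra.
  rewrite mulrAC ler_pdivrMr//; move: MB; rewrite ler_pdivrMr//.
  by rewrite mulrC [r1 * _]mulrC.
have [Aat Lat] := lqa n a t Nw Tt.
split => //; split; last by split.
apply: (hr n) => //; last exact: pw.
have -> : a + t *: u - alpha0 = (a - alpha0) + t *: u by rewrite addrAC.
apply: le_lt_trans (hC _) _; rewrite mulrC -ltr_pdivlMr//.
apply: le_lt_trans (ler_normD _ _) _.
have -> : r / C = r1 + r1 by rewrite /r1; field; rewrite gt_eqF.
by apply: ltr_leD => //; apply: le_lt_trans (norm_le_snorm _) cw.
Unshelve. all: by end_near. Qed.

End penalty.

Section score.
Context (R : realType) (dy dx drho dth : nat) (H : completeNormedModType R).
Context (M : population dy dx drho dth H) (D : design dth H).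
Context (d : measure_display) (Om : measurableType d) (P : probability Om R).
Context (S : sample dy dx drho dth H Om).
Hypotheses (hM : model_ok M) (hD : design_ok M D) (hAos : Aos_ok M D).
Hypotheses (hV : tangent_ok M D) (hphi : riesz_ok M D).
Hypotheses (hahat : psmd M D P S) (hM0 : M0_large M D P S).
Hypotheses (hID : cond_ID M D) (hPEN : cond_PEN M D).
Hypotheses (hCRIT : cond_CRIT M D P S) (hLOC : cond_LOC M D P S).
Hypotheses (hPHI : cond_PHI M D) (hLQA : cond_LQA M D P S).

Local Notation alpha0 := (alpha0 M).
Local Notation sc n w := (Zn M D S n w + ip M (ustar M D n) (ahat S n w - alpha0)).

(** First-order condition of the approximate minimizer. Moving from the estimator
    by [+- t] along [ustar] cannot decrease the penalized criterion by more than
    the tolerances [eta] and [g]. In the quadratic expansion this reads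
    [- (+- t) * X <= const * (eta + g + t ^+ 2) + small * t / sqrt n], with [X]
    the linear coefficient. Dividing by [t] bounds [`|X|], and the choice
    [t ^+ 2 = eta + g] makes all terms [o(n^{-1/2})]. *)
Lemma score_oP1 : oP1 P (fun n w => Num.sqrt n%:R * sc n w).
Proof.
move=> e e0.
have [g [g_bd g_o pen_g]] := penalty_gap hM hAos hM0 hPEN hLOC.
have [inA _ opt] := hahat.
have [_ lqa [_ _ bB] _] := hLQA.
have M00 := M0_gt0 hM hM0 hPEN.
have inN := ahat_Nosn hM hD hAos hV hphi hahat hM0 hID hPEN hCRIT hLOC hPHI.
(* the step sqrt (eta + g) is at most (1 + M0 + 1) * delta *)
have shift := ahat_shift_Aosn hM hD hAos hV hphi hahat hM0 hID hPEN hCRIT hLOC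
  hPHI hLQA (1 + M0 D + 1).
apply: (wpa1_bounded opt) => K; apply: (wpa1_bounded bB) => L.
have e2 : 0 < e / 2 by lra.
apply: wpa1_sub (wpa1I inN (wpa1I shift (lqa _ e2))).
pose s n := eta D n + g n.
pose k := 1 + `|K| + `|L| + e.
have k0 : 0 < k by rewrite /k; have := normr_ge0 K; have := normr_ge0 L; lra.
have so : (n%:R * s n) @[n --> \oo] --> (0 : R).
  have [_ [_ eo] _ _] := hD.
  have -> : (fun n => n%:R * s n) = (fun n => n%:R * eta D n + n%:R * g n).
    by apply/funext => n; rewrite /s mulrDr.
  by rewrite -[X in _ --> X]addr0; exact: cvgD.
have ek : 0 < e / (2 * k) by rewrite divr_gt0// mulr_gt0.
near=> n => w [/= [Aa Na] [sh lq]] BL op.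
have n0 : 0 < n%:R :> R by rewrite ltr0n; near: n; exact: nbhs_infty_gt.
have eta0 := eta_gt0 hD n; have /andP[gn0 gnM] := g_bd n.
have [lle ele _] := rates_le hLOC n; have d0 := delta_gt0 hD n.
have sn0 : 0 < s n by rewrite /s; lra.
set a := ahat S n w in Aa Na sh lq op *; set u := ustar M D n in sh lq *.
set X := sc n w.
pose t := Num.sqrt (s n); have t0 : 0 < t by rewrite sqrtr_gt0.
have t2 : t ^+ 2 = s n by rewrite sqr_sqrtr// ltW.
have td : t <= (1 + M0 D + 1) * delta D n.
  apply: sqr_le_linear; [by lra|exact: ltW|exact: ltW|].
  rewrite t2 /s mulrDl mul1r lerD// (le_trans gnM)// ler_wpM2l//; exact: ltW.
pose r : R := (Num.sqrt n%:R)^-1; have r0 : 0 < r by rewrite invr_gt0 sqrtr_gt0.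
have BL' : Bn S n w <= `|L|.
  apply: le_trans (ler_norm _) _; apply: (le_trans BL).
  by rewrite mulr1 ler_norm.
have side (b : R) : b ^+ 2 = 1 -> - (b * X) <= k * t + e / 2 * r.
  move=> b2.
  have bt : `|b * t| = t.
    have /eqP : b ^+ 2 == 1 by rewrite b2.
    rewrite normrM (gtr0_norm t0) => _.
    suff -> : `|b| = 1 by rewrite mul1r.
    by apply/eqP; rewrite -sqrp_eq1// real_normK ?num_real// b2.
  have btd : `|b * t| <= (1 + M0 D + 1) * delta D n by rewrite bt.
  have [Tt Aat] := sh (b * t) btd; have := lq a (b * t) Na Tt.
  set at_ := a + (b * t) *: u in Aat *; rewrite -/X.
  have bt2 : (b * t) ^+ 2 = s n by rewrite exprMn b2 mul1r.
  rewrite /rn bt2 -/r; set m := Num.max (s n) _ => hl.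
  have m0 : 0 < m by rewrite lt_max sn0.
  have ms : m <= s n + t * r.
    have tr0 : 0 < t * r by exact: mulr_gt0.
    rewrite !ge_max; apply/and3P; split; [by lra| |by rewrite /s; lra].
    have btt : b * t <= t by rewrite -[leRHS]bt ler_norm.
    have : b * t * r <= t * r by rewrite ler_pM2r.
    by lra.
  have {hl} : `|Lambda_hat M S n w at_ a - b * t * X - Bn S n w / 2 * s n| <=
      e / 2 * (s n + t * r).
    rewrite mulrC -ler_pdivlMr ?invr_gt0// invrK in hl.
    by apply: (le_trans hl); rewrite ler_pM2l.
  have : - (1 + `|K|) * s n <= 2 * Lambda_hat M S n w at_ a.
    have [p pE _] := Aos_Pen hM hAos hPEN Aa.1.
    have [q qE _] := Aos_Pen hM hAos hPEN Aat.1.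
    have := pen_g n _ _ Aat.1 Aa.1; rewrite pE qE -!EFinM -EFinD lee_fin => pq.
    have : (crit M D S n w a <= crit M D S n w at_ + (K * eta D n)%:E)%E.
      apply: le_trans op _; rewrite leeD2r//; apply: ereal_inf_lbound.
      by exists at_ => //; case: Aat.
    rewrite /crit pE qE -!EFinM -!EFinD lee_fin => cr.
    have Ke : K * eta D n <= `|K| * s n.
      apply: (@le_trans _ _ (`|K| * eta D n)); first by rewrite ler_wpM2r ?ler_norm// ltW.
      by rewrite ler_wpM2l// /s; lra.
    rewrite /Lambda_hat mulVKf// /s mulNr mulrDl mul1r -/(s n).
    by rewrite /s in Ke *; lra.
  move=> h1; rewrite ler_norml => /andP[h2 h3].
  rewrite -(ler_pM2r t0).
  have -> : (k * t + e / 2 * r) * t = k * t ^+ 2 + e / 2 * (t * r) by ring.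
  rewrite t2.
  have hB : Bn S n w * s n <= `|L| * s n by rewrite ler_pM2r.
  have -> : k * s n = s n + `|K| * s n + `|L| * s n + e * s n by rewrite /k; ring.
  have Ks : 0 <= `|K| * s n by rewrite mulr_ge0// ltW.
  have Ls : 0 <= `|L| * s n by rewrite mulr_ge0// ltW.
  have es : 0 < e * s n by rewrite mulr_gt0.
  have -> : - (b * X) * t = - (b * t * X) by ring.
  by lra.
have Xle : `|X| <= k * t + e / 2 * r.
  rewrite ler_norml; have := side 1 (expr1n _ _).
  have := side (-1); rewrite sqrrN expr1n => /(_ erefl); lra.
rewrite normrM ger0_norm ?sqrtr_ge0//.
apply: (@le_trans _ _ (Num.sqrt n%:R * (k * t + e / 2 * r))).
  by rewrite ler_wpM2l ?sqrtr_ge0.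
rewrite mulrDr mulrCA [Num.sqrt _ * (e / 2 * r)]mulrCA divff ?gt_eqF ?sqrtr_gt0//.
rewrite /t -sqrtrM ?ler0n//.
have : Num.sqrt (n%:R * s n) <= e / (2 * k).
  rewrite -[leRHS](@ger0_norm R) ?(ltW ek)// -sqrtr_sqr ler_wsqrtr//.
  by apply/ltW; near: n; apply: (cvgr_lt _ so); exact: (exprn_gt0 2 ek).
rewrite -(ler_pM2l k0).
have -> : k * (e / (2 * k)) = e / 2 by field; rewrite gt_eqF.
rewrite mulr1; lra.
Unshelve. all: by end_near. Qed.

End score.

(** * The sieve Riesz representer and the limit law *)

Section representer.
Context (R : realType) (dy dx drho dth : nat) (H : completeNormedModType R).
Context (M : population dy dx drho dth H) (D : design dth H).
Hypotheses (hM : model_ok M) (hV : tangent_ok M D) (hphi : riesz_ok M D).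
Hypotheses (hID : cond_ID M D) (hPHI : cond_PHI M D).

Local Notation E := ('rV[R]_dth * H)%type.
Local Notation alpha0 := (alpha0 M).
Local Notation vst := (vstar D).

Lemma Lk_lin n c (v w : E) : Lk D n v -> Lk D n w -> Lk D n (c *: v + w).
Proof.
move=> [a /= va] [b /= wb]; exists (fun i => c * a i + b i) => /=.
rewrite va wb scaler_sumr -big_split/=; apply: eq_bigr => i _.
by rewrite scalerDl scalerA.
Qed.

Lemma Vk_sub_Lk n : Vk M D n `<=` Lk D n.
Proof.
have [_ _ /(_ n)[L0 _] _ _] := hphi.
apply: span_min.
- by exists (fun=> 0) => /=; rewrite big1// => i _; rewrite scale0r.
- by move=> *; exact: Lk_lin.
- move=> _ [a [_ [_ La]] <-]; rewrite addrC -scaleN1r; exact: Lk_lin.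
Qed.

Lemma Vk_sub_Vbar n : Vk M D n `<=` Vbar M D.
Proof. by have [[_ _ /(_ n)[h _] _ _] _ _] := hPHI. Qed.

Lemma vstar_Vbar n : Vbar M D (vst n).
Proof. by have [_ _ _ _ /(_ n)[h _]] := hphi; exact: Vk_sub_Vbar h. Qed.

Lemma alpha0n_Vbar n a : Aosn M D n a -> Vbar M D (alpha0n D n - alpha0).
Proof.
move=> Aa; have h := VbarZD hV (-1) (Vk_sub_Vbar (Aosn_Vk Aa)) (Aos_Vbar M Aa.1).
have e : alpha0n D n - alpha0 = (-1) *: (a - alpha0n D n) + (a - alpha0).
  by rewrite scaleN1r opprB subrKA.
by rewrite e.
Qed.

(** [alpha0n] is the projection of [alpha0] on the linear sieve, of which the
    representer is a direction. *)
Lemma ip_vstar_alpha0n n a : Aosn M D n a ->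
  ip M (alpha0n D n - alpha0) (vst n) = 0.
Proof.
move=> Aa; have [_ _ /(_ n)[L0 Lmin] _ /(_ n)[Vv _]] := hphi.
have V0 := alpha0n_Vbar Aa.
apply: (semi_ip_min_orth (VbarZD hV) _ (ipZDl hM hV hID) _ V0 (vstar_Vbar n)).
- by move=> ? ? /(Vbar_diff_dir hV) ? /(Vbar_diff_dir hV) ?; exact: (ipC hM).
- by move=> ? /(Vbar_diff_dir hV) ?; exact: (ip_ge0 hM).
- move=> t; have Vt := VbarZD hV t (vstar_Vbar n) V0.
  rewrite -(wnorm_sqr hM (Vbar_diff_dir hV V0)).
  rewrite -(wnorm_sqr hM (Vbar_diff_dir hV Vt)).
  apply: lerXn2r; [by rewrite nnegrE wnorm_ge0|by rewrite nnegrE wnorm_ge0|].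
  rewrite addrA; apply: Lmin; apply: Lk_lin; [exact: Vk_sub_Lk|exact: L0].
Qed.

(** Split [a - alpha0] at [alpha0n]: the representer computes [phidot] on the
    part inside the sieve and is orthogonal to the approximation error, whose
    image under [phidot] remains as a bias. *)
Lemma ip_vstar n a : Aosn M D n a ->
  ip M (vst n) (a - alpha0) = phidot M (a - alpha0) - phidot M (alpha0n D n - alpha0).
Proof.
move=> Aa; have orth := ip_vstar_alpha0n Aa.
have [_ [_ lin _] _ _ /(_ n)[Vv rep]] := hphi.
have Va := Aosn_Vk Aa; have VVa := Vk_sub_Vbar Va.
have Vd := Aos_Vbar M Aa.1.
have dd := Vbar_diff_dir hV.
have V0 := alpha0n_Vbar Aa.
have e1 : a - alpha0 = 1 *: (a - alpha0n D n) + (alpha0n D n - alpha0).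
  by rewrite scale1r subrKA.
have h1 := ipZDl hM hV hID 1 VVa V0 (vstar_Vbar n).
rewrite -e1 orth addr0 mul1r in h1.
have h2 := lin 1 (a - alpha0n D n) (alpha0n D n - alpha0).
rewrite -e1 mul1r in h2.
rewrite (ipC hM (dd _ (vstar_Vbar n)) (dd _ Vd)) h1.
rewrite (ipC hM (dd _ VVa) (dd _ (vstar_Vbar n))) -(rep _ Va).
by rewrite h2 addrK.
Qed.

Lemma ip_ustar n v : Vbar M D v ->
  ip M (ustar M D n) v = (sdnorm M (vst n))^-1 * ip M (vst n) v.
Proof.
move=> Vv; have V00 : Vbar M D 0.
  by have := VbarZD hV (-1) Vv Vv; rewrite scaleN1r addNr.
have e c : ip M (c *: vst n) v = c * ip M (vst n) v + ip M 0 v.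
  by have := ipZDl hM hV hID c (vstar_Vbar n) V00 Vv; rewrite addr0.
have z : ip M 0 v = 0.
  have h := e 1; rewrite scale1r mul1r in h.
  by apply: (addrI (ip M (vst n) v)); rewrite addr0 -h.
by rewrite /ustar e z addr0.
Qed.

End representer.

Lemma measurable_comp_open d (T : measurableType d) (R : realType)
    (V : topologicalType) (f : T -> V) (g : V -> R) :
  (forall U, open U -> measurable (f @^-1` U)) -> continuous g ->
  measurable_fun setT (g \o f).
Proof.
move=> mf cg; apply: (measurability _ (RGenOpens.measurableE R)).
move=> _ [_ [a [b ->] <-]]; rewrite setTI comp_preimage; apply: mf.
by apply: open_comp => [x _|]; [exact: cg|exact: interval_open].
Qed.

(** With the convention [x / 0 = 0] the case [s = 0] is trivial, and the last
    hypothesis excludes [w = 0 < s]. *)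
Lemma norm_div_le (R : realType) (x w s C : R) :
  0 <= C -> 0 <= s -> 0 <= w -> w <= C * s -> (w = 0 -> s = 0) ->
  `|x / s| <= C * (`|x| / w).
Proof.
move=> C0 s0 w0 ws zz.
have [->|sN] := eqVneq s 0; first by rewrite invr0 mulr0 normr0 mulr_ge0// divr_ge0.
have wp : 0 < w by rewrite lt_neqAle w0 andbT; apply: contra_neq sN => w0'; exact: zz.
have sp : 0 < s by rewrite lt_neqAle eq_sym sN.
rewrite normrM normfV (gtr0_norm sp) mulrA ler_pdivlMr// mulrAC ler_pdivrMr//.
by rewrite [leRHS]mulrAC [leRHS]mulrC ler_wpM2l.
Qed.

Theorem theorem4p1 (R : realType) (dy dx drho dth : nat)
    (H : completeNormedModType R)
    (M : population dy dx drho dth H) (D : design dth H)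
    (d : measure_display) (Om : measurableType d) (P : probability Om R)
    (S : sample dy dx drho dth H Om)
    (hM : model_ok M) (hD : design_ok M D) (hAos : Aos_ok M D)
    (hV : tangent_ok M D) (hphi : riesz_ok M D) (hS : sample_ok M P S)
    (hahat : psmd M D P S) (hM0 : M0_large M D P S)
    (hID : cond_ID M D) (hPEN : cond_PEN M D)
    (hCRIT : cond_CRIT M D P S) (hLOC : cond_LOC M D P S)
    (hPHI : cond_PHI M D) (hLQA : cond_LQA M D P S) :
  let T n w := Num.sqrt n%:R * (phi M (ahat S n w) - phi M (alpha0 M))
                 / sdnorm M (vstar D n) in
  oP1 P (fun n w => T n w - - (Num.sqrt n%:R * Zn M D S n w)) /\
  cvg_in_law P T (normal_prob 0 1).
Proof.
move=> T.
have oT : oP1 P (fun n w => T n w - - (Num.sqrt n%:R * Zn M D S n w)).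
  move=> e e0.
  have [C C0 wC] := wnorm_le_sdnorm hM hID.
  have inN := ahat_Nosn hM hD hAos hV hphi hahat hM0 hID hPEN hCRIT hLOC hPHI.
  have sc := score_oP1 hM hD hAos hV hphi hahat hM0 hID hPEN hCRIT hLOC hPHI hLQA.
  have [_ lin_phi bias] := hPHI.
  have e1 : 0 < e / 2 by lra.
  have C1 : 0 < C + 1 by lra.
  have e2 : 0 < e / (4 * (C + 1)) by rewrite divr_gt0// mulr_gt0.
  apply: wpa1_sub (wpa1I inN (sc _ e1)).
  near=> n => w [/= [Aa Na] sco].
  have lp : forall a t, Nosn M D n a -> Tn M D n t ->
        let at_ := a + t *: ustar M D n in
        Num.sqrt n%:R *
          `|phi M at_ - phi M (alpha0 M) - phidot M (at_ - alpha0 M)|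
          / wnorm M (vstar D n) <= e / (4 * (C + 1)).
    by near: n; exact: lin_phi.
  have T0 : Tn M D n 0 by rewrite /Tn/= normr0; exact: Tn_ge0.
  have := lp _ 0 Na T0; rewrite scale0r addr0 /= => {}lp.
  have bi : `|Num.sqrt n%:R * `|phidot M (alpha0n D n - alpha0 M)|
         / wnorm M (vstar D n)| <= e / (4 * (C + 1)).
    by near: n; move/cvgr0Pnorm_le : bias; exact.
  set a := ahat S n w in Aa Na sco lp *.
  have Vd := Aos_Vbar M Aa.1.
  rewrite (ip_ustar hM hV hphi hID hPHI n Vd) (ip_vstar hM hV hphi hID hPHI Aa) in sco.
  have vV := vstar_Vbar hphi hPHI n.
  have ws := wC _ (Vbar_diff_dir hV vV).
  have ws0 : wnorm M (vstar D n) = 0 -> sdnorm M (vstar D n) = 0.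
    have [_ _ _ _ /(_ n)[Vv _]] := hphi.
    by move=> /(Vk_wnorm0 hPHI Vv) ->; exact: sdnorm_zero.
  have nd x := norm_div_le x C0 (sdnorm_ge0 M (vstar D n))
     (wnorm_ge0 M (vstar D n)) ws ws0.
  set sd := sdnorm _ _ in ws ws0 nd sco *; set wn := wnorm _ _ in lp bi ws ws0 nd *.
  set q := Num.sqrt n%:R in sco lp bi *; have q0 : 0 <= q by exact: sqrtr_ge0.
  set f1 := phi M a - phi M (alpha0 M) in lp *.
  set f2 := phidot M (a - alpha0 M) in lp sco *.
  set f3 := phidot M (alpha0n D n - alpha0 M) in bi sco.
  have h1 := nd (q * (f1 - f2)); have h2 := nd (q * f3).
  (* first-order condition, linearization error and bias of the sieve *)
  have -> : T n w - - (q * Zn M D S n w) =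
     q * (Zn M D S n w + sd^-1 * (f2 - f3)) + q * (f1 - f2) / sd + q * f3 / sd.
    by rewrite /T -/a -/f1 -/q -/sd; ring.
  have k1 : `|q * (f1 - f2)| / wn <= e / (4 * (C + 1)).
    by rewrite normrM (ger0_norm q0).
  have k2 : `|q * f3| / wn <= e / (4 * (C + 1)).
    by rewrite normrM (ger0_norm q0); apply: le_trans (ler_norm _) bi.
  have k3 x : x <= e / (4 * (C + 1)) -> C * x <= e / 4.
    move=> xe; apply: (@le_trans _ _ (C * (e / (4 * (C + 1))))).
      by rewrite ler_wpM2l.
    apply: (@le_trans _ _ ((C + 1) * (e / (4 * (C + 1))))).
      by rewrite ler_wpM2r ?(ltW e2)//; lra.
    have -> : (C + 1) * (e / (4 * (C + 1))) = e / 4 by field; lra.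
    by [].
  apply: le_trans (ler_normD _ _) _.
  apply: (@le_trans _ _ (e / 2 + e / 4 + e / 4)); last by lra.
  apply: lerD; last exact: le_trans h2 (k3 _ k2).
  apply: le_trans (ler_normD _ _) _.
  by apply: lerD; [exact: sco|exact: le_trans h1 (k3 _ k1)].
split=> //.
have [_ _ _ clt] := hLQA.
apply: cvg_in_law_oppD_oP1 clt oT => n.
have [_ mah _] := hahat; have [cphi _ _ _ _] := hphi.
have mphi : measurable_fun setT (phi M \o ahat S n).
  by apply: measurable_comp_open cphi => U; exact: mah.
rewrite /T; apply: measurable_funM => //; apply: measurable_funM => //.
exact: measurable_funB.
Unshelve. all: by end_near. Qed.
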